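(* Let $n \ge 26$ and let $G$ be a red-blue colouring of $K_n$. Then $\mathrm{pack}(G) \ge \lfloor (n-1)^2/4 \rfloor$, with equality if and only if one of $G_R$ and $G_B$ is obtained from a balanced complete bipartite graph $K_{\lceil n/2\rceil, \lfloor n/2 \rfloor}$ (on vertex set $V(G)$) by removing a matching.
   Context: A red-blue colouring $G$ of $K_n$ assigns red or blue to each edge of the complete graph on the $n$-vertex set $V(G)$; $G_R$ and $G_B$ are the spanning subgraphs formed by the red and the blue edges respectively. For a graph $F$, a fractional triangle packing is a function $\omega$ from the set of triangles of $F$ to $[0,1]$ such that $\sum_{T \ni e} \omega(T) \le 1$ for every edge $e$ of $F$ (sum over triangles $T$ of $F$ containing $e$); $\nu^*(F)$ is the maximum of $\sum_T \omega(T)$ over all fractional triangle packings $\omega$ of $F$. Define $\mathrm{pack}(G) = 3(\nu^*(G_R) + \nu^*(G_B))$. *)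

(* Defs.v *)
From HB Require Import structures.
From mathcomp Require Import all_boot all_order all_algebra.
From mathcomp Require Import classical_sets reals.
Set Implicit Arguments. Unset Strict Implicit. Unset Printing Implicit Defensive.
Import Order.TTheory GRing.Theory Num.Theory.
Local Open Scope ring_scope.


Section Defs.
Variable V : finType.

(* A simple graph on V is given by an adjacency relation (assumed symmetric
   and irreflexive where used). *)
Definition is_edge (F : rel V) (e : {set V}) : bool :=
  [exists x, exists y, [&& x != y, F x y & e == [set x; y]]].

Definition is_triangle (F : rel V) (T : {set V}) : bool :=
  (#|T| == 3)%N && [forall x in T, forall y in T, (x != y) ==> F x y].

Variable R : realType.

Definition frac_tri_packing (F : rel V) (w : {set V} -> R) : Prop :=
  (forall T, is_triangle F T -> 0 <= w T <= 1) /\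
  (forall e, is_edge F e ->
     \sum_(T | is_triangle F T && (e \subset T)) w T <= 1).

Definition packing_value (F : rel V) (w : {set V} -> R) : R :=
  \sum_(T | is_triangle F T) w T.

(* nu^*(F): maximum (= supremum, the set being nonempty, bounded and
   attained) of the values of fractional triangle packings *)
Definition nu_star (F : rel V) : R :=
  sup [set packing_value F w | w in [set w | frac_tri_packing F w]]%classic.

Definition red_graph (col : rel V) : rel V := fun x y => (x != y) && col x y.
Definition blue_graph (col : rel V) : rel V := fun x y => (x != y) && ~~ col x y.

Definition pack (col : rel V) : R :=
  3 * (nu_star (red_graph col) + nu_star (blue_graph col)).

Definition bip_minus_matching (F : rel V) : Prop :=
  exists (A : {set V}) (M : rel V),
    #|A| = uphalf #|V| /\ #|~: A| = (#|V| ./2)%N /\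
    symmetric M /\
    (forall x y, M x y -> (x \in A) != (y \in A)) /\
    (forall x y z, M x y -> M x z -> y = z) /\
    (forall x y, F x y = ((x \in A) != (y \in A)) && ~~ M x y).
End Defs.

(* Main.v *)
Require Import Defs.
From mathcomp Require Import all_boot all_order all_algebra.
From mathcomp Require Import classical_sets reals.
(* Imported again so that its lemmas take precedence over [classical_sets]. *)
From mathcomp Require Import boolp fintype finset.
From mathcomp Require Import lra ring zify.
Import Order.TTheory GRing.Theory Num.Theory.
Local Open Scope ring_scope.
Set Implicit Arguments. Unset Strict Implicit. Unset Printing Implicit Defensive.

(** By linear programming duality there is a weighting [c >= 0] of the pairs of
    vertices with total weight at most [pack / 3], in which every monochromatic
    triangle weighs at least 1; so one has to bound the weight of such covers.

    A counting argument of Goodman shows that a 6-set (7-set) weighs at least 2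
    (7/2) unless it contains two vertices of total degree at least 2. Hence a
    lightest 5-set of weight at most 1, or a lightest 6-set, receives weight at
    least 1 from every other vertex. If some 5-set weighs at most 1, removing
    lightest 5-sets gives more than is needed. Otherwise all 6-sets weigh at
    least 2, and removing lightest 6-sets gives the exact bound when [n] is 0, 1
    or 2 modulo 6; the other residues follow by averaging over one vertex or over
    the pairs of a light perfect matching of a lightest 6-set.

    In a cover of equality every 6-set of weight 2 splits into two monochromatic
    triangles with weight 1/3 on their edges and 0 across. Exchanging vertices of
    such 6-sets spreads this to a balanced bipartition of the whole vertex set,
    after which the cover inequality determines the colours up to a matching.
    Conversely, that weighting covers the complement of a balanced complete
    bipartite graph minus a matching. *)

(** * Linear programming duality *)

Section Farkas.
Variables (R : realFieldType) (D : finType).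
Implicit Types (a b x : D -> R).

Definition dot a x : R := \sum_d a d * x d.

Lemma dotBl a b k x : dot (fun d => a d - k * b d) x = dot a x - k * dot b x.
Proof.
rewrite /dot mulr_sumr -sumrB; apply: eq_bigr => d _.
by rewrite mulrBl mulrA.
Qed.

Lemma dotBr a x y k : dot a (fun d => x d - k * y d) = dot a x - k * dot a y.
Proof.
rewrite /dot mulr_sumr -sumrB; apply: eq_bigr => d _.
by rewrite mulrBr mulrCA.
Qed.

(* Bartl's induction on the number of forms: if the last form [A i] is needed,
   a point [x0] violating the conclusion has [A i x0 > 0], and every form can
   be projected along [x0] onto the kernel of [A i]. *)
Lemma farkas (I : eqType) (s : seq I) (A : I -> D -> R) (g : D -> R) :
  uniq s ->
  (forall x, (forall i, i \in s -> dot (A i) x <= 0) -> dot g x <= 0) ->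
  exists l : I -> R, (forall i, 0 <= l i) /\
    (forall d, g d = \sum_(i <- s) l i * A i d).
Proof.
elim: s A g => [|i s IH] A g.
  move=> _ H; exists (fun=> 0); split=> // d; rewrite big_nil.
  have /H: forall i : I, i \in [::] -> dot (A i) g <= 0 by [].
  move=> g2; have g0 : \sum_d g d * g d = 0.
    apply/eqP; rewrite eq_le g2 /=; apply: sumr_ge0 => k _.
    by rewrite -expr2 sqr_ge0.
  have g_ge0 k : true -> 0 <= g k * g k by rewrite -expr2 sqr_ge0.
  by apply/eqP; rewrite -sqrf_eq0 expr2 (psumr_eq0P g_ge0 g0).
rewrite [uniq _]/= => /andP[nis us] H.
have [H'|] := pselect
  (forall x, (forall j, j \in s -> dot (A j) x <= 0) -> dot g x <= 0).
  have [l [l0 lE]] := IH A g us H'.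
  exists (fun j => if j == i then 0 else l j); split=> [j|d].
    by case: ifP.
  rewrite big_cons eqxx mul0r add0r lE; apply: eq_big_seq => j js.
  by case: eqP js nis => // ->  ->.
move=> /existsNP[x0 /not_implyP[x0s /negP]]; rewrite -ltNge => gx0.
have ax0 : 0 < dot (A i) x0.
  rewrite ltNge; apply/negP => ax; move: gx0; rewrite ltNge => /negP; apply.
  apply: H => j; rewrite inE => /orP[/eqP -> //|]; exact: x0s.
set a := dot (A i) x0 in ax0.
pose B j d := A j d - dot (A j) x0 / a * A i d.
pose h d := g d - dot g x0 / a * A i d.
have Hh : forall x, (forall j, j \in s -> dot (B j) x <= 0) -> dot h x <= 0.
  move=> x Bx; pose x' d := x d - dot (A i) x / a * x0 d.
  have gx' : dot g x' <= 0.
    apply: H => j; rewrite inE => /orP[/eqP ->|js].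
      by rewrite /x' dotBr -/a divfK ?subrr // gt_eqF.
    rewrite (_ : dot _ _ = dot (B j) x) ?Bx //.
    by rewrite /B /x' dotBl dotBr; ring.
  rewrite (_ : dot h x = dot g x') // /h /x' dotBl dotBr; ring.
have [l [l0 lE]] := IH B h us Hh.
exists (fun j => if j == i then dot g x0 / a - \sum_(j <- s) l j * (dot (A j) x0 / a)
  else l j); split=> [j|d].
  case: ifP => // _; rewrite subr_ge0; apply: (@le_trans _ _ 0).
    rewrite big_seq; apply: sumr_le0 => k ks.
    by rewrite mulr_ge0_le0 // mulr_le0_ge0 ?x0s // invr_ge0 ltW.
  by rewrite divr_ge0 ?ltW.
rewrite big_cons eqxx.
have -> : \sum_(j <- s) (if j == i then dot g x0 / a -
    \sum_(j <- s) l j * (dot (A j) x0 / a) else l j) * A j d =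
    \sum_(j <- s) l j * A j d.
  by apply: eq_big_seq => j js; case: eqP js nis => // -> ->.
have := lE d; rewrite /h /B => /eqP; rewrite subr_eq => /eqP ->.
rewrite mulrBl [RHS]addrC [RHS]addrA [RHS]addrAC; congr (_ + _).
by rewrite mulr_suml -sumrB; apply: eq_bigr => j _; ring.
Qed.

End Farkas.

Section Duality.
Variables (R : realFieldType) (E J : finType) (edge : pred E) (tri : pred J).
Variables (inc : E -> J -> bool) (nu : R).
Hypothesis inc_ex : forall j, tri j -> exists2 i, edge i & inc i j.
Hypothesis nuP : forall w : J -> R, (forall j, tri j -> 0 <= w j) ->
  (forall i, edge i -> \sum_(j | tri j && inc i j) w j <= 1) ->
  \sum_(j | tri j) w j <= nu.

(** Farkas' lemma for the homogenised program: coordinate [None] is a scaling factor, the forms [A]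
    express nonnegativity and the edge constraints, and [g] is the packing value minus [nu] times
    the scale. The multipliers of the edge constraints form the cover. *)
Lemma fractional_cover : exists y : E -> R,
  [/\ forall i, 0 <= y i,
      forall j, tri j -> 1 <= \sum_(i | edge i && inc i j) y i &
      \sum_(i | edge i) y i <= nu].
Proof.
pose g (d : option J) : R := if d is Some j then (tri j)%:R else - nu.
pose A (k : (option J + E)%type) (d : option J) : R :=
  match k, d with
  | inl (Some j'), Some j => - (j == j')%:R
  | inl None, None => - 1
  | inl _, _ => 0
  | inr i, Some j => (edge i && tri j && inc i j)%:R
  | inr i, None => - (edge i)%:R
  end.
have dotE (a : option J -> R) x :
    dot a x = a None * x None + \sum_j a (Some j) * x (Some j).
  rewrite /dot (bigD1 None) //=; congr (_ + _).
  rewrite (reindex_omap (Some : J -> option J) id) /=; last by case.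
  by apply: eq_bigl => j; rewrite eqxx.
have [] := @farkas R _ _ (index_enum (option J + E)%type) A g.
- exact: index_enum_uniq.
- move=> x Hx.
  have s0 : 0 <= x None.
    have := Hx (inl None) (mem_index_enum _); rewrite dotE /=.
    rewrite big1 => [|j _]; last by rewrite mul0r.
    by rewrite addr0 mulN1r oppr_le0.
  have w0 j : 0 <= x (Some j).
    have := Hx (inl (Some j)) (mem_index_enum _); rewrite dotE /= mul0r add0r.
    rewrite (bigD1 j) //= eqxx mulN1r big1 ?addr0 ?oppr_le0 // => k kj.
    by rewrite (negPf kj) oppr0 mul0r.
  have we i : edge i -> \sum_(j | tri j && inc i j) x (Some j) <= x None.
    move=> ei; have := Hx (inr i) (mem_index_enum _); rewrite dotE /= ei mulN1r.
    rewrite addrC subr_le0; apply: le_trans; rewrite big_mkcond ler_sum // => j _.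
    by rewrite andTb; case: ifP => _; rewrite ?mul1r ?mul0r.
  rewrite dotE /= mulNr addrC subr_le0.
  have -> : \sum_j (tri j)%:R * x (Some j) = \sum_(j | tri j) x (Some j).
    by rewrite [RHS]big_mkcond; apply: eq_bigr => j _; case: ifP; rewrite ?mul1r ?mul0r.
  have [sp|] := ltP 0 (x None).
    rewrite -ler_pdivrMr // mulr_suml; apply: nuP => [j _|i ei].
      by rewrite divr_ge0.
    by rewrite -mulr_suml ler_pdivrMr // mul1r we.
  (* At scale zero the edge constraints bound every weight by 0, and [inc_ex] puts each [j] under
     one of them. *)
  move=> sn; have s00 : x None = 0 by apply/eqP; rewrite eq_le sn.
  rewrite s00 mulr0; apply: sumr_le0 => j tj.
  have [i ei ij] := inc_ex tj; apply: le_trans (_ : _ <= x None) _; last by rewrite s00.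
  apply: le_trans (we i ei); rewrite (bigD1 j) ?tj //= lerDl.
  by apply: sumr_ge0.
move=> l [l0 lE]; exists (fun i => l (inr i)); split=> [//|j tj|].
- have := lE (Some j); rewrite /= tj big_sumType /= => h; have h1 : 1 = _ := h.
  have : 1 <= \sum_(i : E) l (inr i) * (edge i && tri j && inc i j)%:R.
    rewrite [leLHS]h1 gerDr; apply: sumr_le0 => -[j'|] _.
      by rewrite mulrN oppr_le0 mulr_ge0 ?ler0n.
    by rewrite mulr0.
  move=> /le_trans; apply; rewrite [leRHS]big_mkcond ler_sum // => i _.
  by rewrite tj andbT; case: ifP => _; rewrite ?mulr1 ?mulr0.
have := lE None; rewrite /= big_sumType /= => h.
rewrite -lerN2 h -sumrN.
have -> : \sum_(i | edge i) - l (inr i) = \sum_i l (inr i) * - (edge i)%:R.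
  by rewrite big_mkcond; apply: eq_bigr => i _; case: (edge i); rewrite ?mulrN1 ?oppr0 ?mulr0.
rewrite gerDr; apply: sumr_le0 => -[j'|] _; first by rewrite mulr0.
by rewrite mulrN1 oppr_le0.
Qed.
End Duality.

(** * Fractional triangle packings *)

Section NuStar.
Variables (V : finType) (R : realType) (F : rel V).
Hypothesis symF : symmetric F.
Implicit Types (x y z : V) (e T : {set V}).

Lemma is_edge2 x y : x != y -> is_edge F [set x; y] = F x y.
Proof.
move=> xy; apply/existsP/idP => [[a /existsP[b /and3P[ab Fab /eqP E]]]|Fxy].
  have := set21 x y; rewrite E => /set2P[]; have := set22 x y; rewrite E => /set2P[].
  - by move=> yb xb; move: xy; rewrite xb yb eqxx.
  - by move=> -> ->.
  - by move=> -> ->; rewrite symF.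
  - by move=> yb xb; move: xy; rewrite xb yb eqxx.
by exists x; apply/existsP; exists y; rewrite xy Fxy eqxx.
Qed.

Lemma is_edgeP e :
  reflect (exists x y, [/\ x != y, F x y & e = [set x; y]]) (is_edge F e).
Proof.
apply: (iffP existsP) => [[x /existsP[y /and3P[xy Fxy /eqP ->]]]|[x [y [xy Fxy ->]]]].
  by exists x, y.
by exists x; apply/existsP; exists y; rewrite xy Fxy eqxx.
Qed.

Lemma is_triangleP T :
  reflect (exists x y z, [/\ [&& x != y, y != z & x != z],
    [&& F x y, F y z & F x z] & T = [set x; y; z]]) (is_triangle F T).
Proof.
apply: (iffP andP) => [[T3 /forall_inP FT]|[x [y [z [/and3P[xy yz xz] /and3P[Fxy Fyz Fxz] ->]]]]].
  have [x xT] : exists x, x \in T by apply/set0Pn; rewrite -card_gt0 (eqP T3).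
  have /cards2P[y [z [yz E]]] : #|T :\ x| == 2.
    by have := cardsD1 x T; rewrite xT (eqP T3) add1n => -[<-].
  have yT : y \in T :\ x by rewrite E set21.
  have zT : z \in T :\ x by rewrite E set22.
  move: yT zT; rewrite !inE => /andP[yx yT] /andP[zx zT].
  have FE a b : a \in T -> b \in T -> a != b -> F a b.
    by move=> aT bT; have /forall_inP/(_ b bT)/implyP := FT a aT.
  exists x, y, z; rewrite !(eq_sym x) yz yx zx !FE ?(eq_sym x) //; split=> //.
  by rewrite -setUA -E setD1K.
split; first by rewrite -setUA cardsU1 cards2 !inE negb_or xy xz yz.
apply/forall_inP => a; rewrite !inE => ha; apply/forall_inP => b; rewrite !inE => hb.
apply/implyP; move: ha hb => /orP[/orP[]|] /eqP-> /orP[/orP[]|] /eqP-> //;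
  rewrite ?eqxx // => _; by rewrite symF.
Qed.

Lemma sum_triangle_edges (f : {set V} -> R) x y z :
  [&& x != y, y != z & x != z] -> [&& F x y, F y z & F x z] ->
  \sum_(e | is_edge F e && (e \subset [set x; y; z])) f e =
  f [set x; y] + f [set y; z] + f [set x; z].
Proof.
move=> /and3P[xy yz xz] /and3P[Fxy Fyz Fxz].
have u : uniq [:: [set x; y]; [set y; z]; [set x; z]].
  rewrite /= !inE !negb_or !andbT; apply/andP; split; first (apply/andP; split).
  - by apply/eqP => /setP/(_ x); rewrite !inE eqxx (negPf xy) (negPf xz).
  - by apply/eqP => /setP/(_ y); rewrite !inE eqxx orbT eq_sym (negPf xy) (negPf yz).
  - by apply/eqP => /setP/(_ x); rewrite !inE eqxx (negPf xy) (negPf xz).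
rewrite -addrA -[f [set x; z]]addr0.
transitivity (\sum_(e <- [:: [set x; y]; [set y; z]; [set x; z]]) f e); last first.
  by rewrite !big_cons big_nil.
rewrite -big_filter; apply: perm_big; apply: uniq_perm => // [|e].
  by rewrite filter_uniq // index_enum_uniq.
rewrite mem_filter mem_index_enum andbT !inE; apply/idP/idP.
  move=> /andP[/is_edgeP[a [b [ab Fab ->]]]]; rewrite subUset !sub1set !inE.
  move=> /andP[ha hb]; move: ab.
  move: ha hb => /orP[/orP[]|] /eqP-> /orP[/orP[]|] /eqP->; rewrite ?eqxx ?orbT //;
    by rewrite setUC eqxx ?orbT.
by case/or3P => /eqP->; rewrite is_edge2 // ?Fxy ?Fyz ?Fxz subUset !sub1set !inE !eqxx ?orbT.
Qed.

Lemma sum_edges (f : {set V} -> R) :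
  \sum_x \sum_(y | (x != y) && F x y) f [set x; y] = 2 * \sum_(e | is_edge F e) f e.
Proof.
rewrite pair_big_dep /=.
rewrite (partition_big (fun p => [set p.1; p.2]) (is_edge F)) /=; last first.
  by case=> x y /andP[xy Fxy]; rewrite is_edge2.
rewrite mulr_sumr; apply: eq_bigr => e /is_edgeP[a [b [ab Fab ->]]].
rewrite (bigD1 (a, b)) /=; last by rewrite ab Fab eqxx.
rewrite (bigD1 (b, a)) /=; last first.
  by rewrite eq_sym ab symF Fab setUC eqxx xpair_eqE negb_and eq_sym ab.
rewrite [X in _ + (_ + X)]big1 => [|[x y] /= /andP[/andP[/andP[/andP[xy Fxy] /eqP E]]]].
  by rewrite addr0 [[set b; a]]setUC; ring.
have := set21 a b; rewrite -E => /set2P[] h; have := set22 a b; rewrite -E => /set2P[] h';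
  by rewrite ?h ?h' ?eqxx // in ab *.
Qed.

Lemma nu_star_has_sup :
  has_sup [set packing_value F w | w in [set w : _ -> R | frac_tri_packing F w]]%classic.
Proof.
split.
  exists 0, (fun=> 0); last by rewrite /packing_value big1.
  split=> [T _|e _]; first by rewrite lexx ler01.
  by rewrite big1 ?ler01.
exists (\sum_(T | is_triangle F T) 1) => _ [w [w01 _] <-].
by apply: ler_sum => T /w01 /andP[].
Qed.

(** A triangle has an edge, whose constraint bounds [w T] by 1; this brings packings into the form
    over which [fractional_cover] quantifies. *)
Lemma packing_value_le (w : {set V} -> R) :
  (forall T, is_triangle F T -> 0 <= w T) ->
  (forall e, is_edge F e -> \sum_(T | is_triangle F T && (e \subset T)) w T <= 1) ->
  packing_value F w <= nu_star R F.
Proof.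
move=> w0 w1; apply: ub_le_sup; first by case: nu_star_has_sup.
exists w => //; split=> // T tT; rewrite w0 //=.
have /is_triangleP[x [y [z [/and3P[xy _ _] /and3P[Fxy _ _] E]]]] := tT.
have := w1 [set x; y]; rewrite is_edge2 // => /(_ Fxy); apply: le_trans.
rewrite (bigD1 T) /= ?lerDl.
  by apply: sumr_ge0 => U /andP[/andP[/w0]].
by rewrite tT E subUset !sub1set !inE !eqxx ?orbT.
Qed.

(** Weak duality: weigh each triangle by its cover and exchange the summations. The factor 2 comes
    from ordered pairs. *)
Lemma nu_star_le (c : V -> V -> R) : (forall x y, c x y = c y x) ->
  (forall x y, 0 <= c x y) ->
  (forall x y z, [&& x != y, y != z & x != z] -> [&& F x y, F y z & F x z] ->
     1 <= c x y + c y z + c x z) ->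
  2 * nu_star R F <= \sum_x \sum_(y | (x != y) && F x y) c x y.
Proof.
move=> csym c0 cT.
(* The symmetric function [c] as a function of edges, averaged over both orders so that no endpoint
   is chosen. *)
pose f e := (\sum_(x in e) \sum_(y in e | y != x) c x y) / 2.
have fE x y : x != y -> f [set x; y] = c x y.
  move=> xy; rewrite /f big_setU1 ?inE //= big_set1.
  rewrite (big_pred1 y) => [|a]; last first.
    by rewrite !inE; case: (eqVneq a y) => [->|_]; rewrite ?(eq_sym y) ?xy ?orbT //= orbF andbN.
  rewrite (big_pred1 x) => [|a]; last first.
    by rewrite !inE; case: (eqVneq a x) => [->|_]; rewrite ?xy //= andbN.
  by rewrite csym; lra.
have f0 e : 0 <= f e.
  by rewrite divr_ge0 // ?sumr_ge0 // => x _; rewrite sumr_ge0.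
have -> : \sum_x \sum_(y | (x != y) && F x y) c x y = 2 * \sum_(e | is_edge F e) f e.
  by rewrite -sum_edges; apply: eq_bigr => x _; apply: eq_bigr => y /andP[xy _]; rewrite fE.
rewrite ler_pM2l //; apply: ge_sup; first by case: nu_star_has_sup.
move=> _ [w [w01 w1] <-]; rewrite /packing_value.
apply: (@le_trans _ _ (\sum_(T | is_triangle F T) \sum_(e | is_edge F e && (e \subset T)) w T * f e)).
  apply: ler_sum => T tT; rewrite -mulr_sumr ler_peMr //; first by case/andP: (w01 _ tT).
  have /is_triangleP[x [y [z [h hF ->]]]] := tT; rewrite sum_triangle_edges //.
  have /and3P[xy yz xz] := h; rewrite !fE //; exact: cT.
rewrite (exchange_big_dep (is_edge F)) /=; last by move=> T e _ /andP[].
apply: ler_sum => e ee; rewrite -mulr_suml ler_piMl //.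
by rewrite (eq_bigl (fun T => is_triangle F T && (e \subset T))) ?w1 // => T; rewrite ee.
Qed.

Lemma nu_star_cover : exists c : V -> V -> R, [/\ forall x y, c x y = c y x,
  forall x y, 0 <= c x y,
  forall x y z, [&& x != y, y != z & x != z] -> [&& F x y, F y z & F x z] ->
     1 <= c x y + c y z + c x z &
  \sum_x \sum_(y | (x != y) && F x y) c x y <= 2 * nu_star R F].
Proof.
have [||f [f0 fT fle]] := @fractional_cover R _ _ (is_edge F) (is_triangle F)
  (fun e T => e \subset T) (nu_star R F).
- move=> T /is_triangleP[x [y [z [/and3P[xy _ _] /and3P[Fxy _ _] ->]]]].
  by exists [set x; y]; rewrite ?is_edge2 // subUset !sub1set !inE !eqxx ?orbT.
- by move=> w w0 w1; exact: packing_value_le.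
exists (fun x y => f [set x; y]); split=> //.
- by move=> x y; rewrite setUC.
- move=> x y z h hF; rewrite -sum_triangle_edges // fT //.
  by apply/is_triangleP; exists x, y, z.
- by rewrite sum_edges ler_pM2l.
Qed.

End NuStar.

(** Each pair has one colour, so a red and a blue cover combine into one weighting. Summing over
    ordered pairs doubles its weight, whence 3 against 2. *)
Lemma pack_cover (V : finType) (R : realType) (col : rel V) : symmetric col ->
  exists c : V -> V -> R, [/\ forall x y, c x y = c y x,
    forall x y, 0 <= c x y, forall x, c x x = 0,
    forall x y z, [&& x != y, y != z & x != z] -> col x y = col y z ->
      col y z = col x z -> 1 <= c x y + c y z + c x z &
    3 * \sum_x \sum_y c x y <= 2 * pack R col].
Proof.
move=> scol.
have sr : symmetric (red_graph col) by move=> x y; rewrite /red_graph eq_sym scol.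
have sb : symmetric (blue_graph col) by move=> x y; rewrite /blue_graph eq_sym scol.
have [r [rsym r0 rT rle]] := nu_star_cover R sr.
have [b [bsym b0 bT ble]] := nu_star_cover R sb.
exists (fun x y => if x == y then 0 else if col x y then r x y else b x y); split.
- by move=> x y; rewrite eq_sym scol rsym bsym.
- by move=> x y; do 2 case: ifP => _ //.
- by move=> x; rewrite eqxx.
- move=> x y z h e1 e2; have /and3P[xy yz xz] := h.
  rewrite (negPf xy) (negPf yz) (negPf xz) e1 e2; case: ifP => cxz.
    by apply: rT => //; rewrite /red_graph xy yz xz e1 e2 cxz.
  by apply: bT => //; rewrite /blue_graph xy yz xz e1 e2 cxz.
rewrite /pack mulrCA ler_pM2l // mulrDr; apply: le_trans (lerD rle ble).
rewrite -big_split /=; apply: ler_sum => x _.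
rewrite [X in _ <= X + _]big_mkcond [X in _ <= _ + X]big_mkcond -big_split /=.
apply: ler_sum => y _; rewrite /red_graph /blue_graph.
by case: eqVneq => _ /=; rewrite ?addr0 //; case: (col x y); rewrite /= ?addr0 ?add0r.
Qed.

(** * Weights of vertex sets and monochromatic triangles *)

Lemma exists_subset (T : finType) (U : {set T}) (k : nat) :
  (k <= #|U|)%N -> exists2 Z : {set T}, Z \subset U & #|Z| = k.
Proof.
move=> kU; have : (0 < #|[set A : {set T} | A \subset U & #|A| == k]|)%N.
  by rewrite cards_draws bin_gt0.
by case/card_gt0P => Z; rewrite inE => /andP[ZU /eqP Zk]; exists Z.
Qed.

Lemma sum_setU (T : finType) (R : nmodType) (A B : {set T}) (F : T -> R) :
  [disjoint A & B] ->
  \sum_(x in A :|: B) F x = \sum_(x in A) F x + \sum_(x in B) F x.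
Proof.
by move=> AB; rewrite -bigU //; apply: eq_bigl => x; rewrite !inE.
Qed.

Lemma sumr_card (T : finType) (R : pzRingType) (S : {set T}) (K : R) :
  \sum_(x in S) K = #|S|%:R * K.
Proof. by rewrite sumr_const mulr_natl. Qed.

Section Weights.
Variables (V : finType) (R : realFieldType) (c : V -> V -> R).
Hypotheses (csym : forall x y, c x y = c y x) (c0 : forall x y, 0 <= c x y).
Hypothesis (cxx : forall x, c x x = 0).
Implicit Types (x y z v p q : V) (U Z S A B Q : {set V}).

Definition wdeg x U := \sum_(y in U) c x y.
(* Sums over ordered pairs, hence twice the total weight inside [U]. *)
Definition wsum U := \sum_(x in U) wdeg x U.

Lemma deg_ge0 x U : 0 <= wdeg x U.
Proof. by apply: sumr_ge0. Qed.

Lemma wt_ge0 U : 0 <= wsum U.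
Proof. by apply: sumr_ge0 => x _; exact: deg_ge0. Qed.

Lemma degU1 x v U : v \notin U -> wdeg x (v |: U) = c x v + wdeg x U.
Proof. exact: big_setU1. Qed.

Lemma degD1 x v U : v \in U -> wdeg x U = c x v + wdeg x (U :\ v).
Proof. by move=> vU; rewrite /wdeg (big_setD1 v). Qed.

Lemma deg_self v U : wdeg v (U :\ v) = wdeg v U.
Proof.
have [vU|vU] := boolP (v \in U); first by rewrite (degD1 v vU) cxx add0r.
by apply: eq_bigl => x; rewrite !inE; case: eqP => // ->; rewrite (negPf vU).
Qed.

Lemma degU x A B : [disjoint A & B] -> wdeg x (A :|: B) = wdeg x A + wdeg x B.
Proof. exact: sum_setU. Qed.

Lemma deg_exchange A B : \sum_(x in A) wdeg x B = \sum_(x in B) wdeg x A.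
Proof.
rewrite /wdeg exchange_big /=; apply: eq_bigr => x _; apply: eq_bigr => y _.
exact: csym.
Qed.

Lemma wtU A B : [disjoint A & B] ->
  wsum (A :|: B) = wsum A + wsum B + 2 * \sum_(v in B) wdeg v A.
Proof.
move=> AB; rewrite /wsum sum_setU //=.
rewrite (eq_bigr (fun x => wdeg x A + wdeg x B)) => [|x _]; last exact: degU.
rewrite [X in _ + X](eq_bigr (fun x => wdeg x A + wdeg x B)) => [|x _]; last exact: degU.
rewrite !big_split /= (deg_exchange A B); ring.
Qed.

Lemma wtU1 v U : v \notin U -> wsum (v |: U) = wsum U + 2 * wdeg v U.
Proof.
move=> vU; rewrite setUC wtU; last by rewrite disjoint_sym disjoints1.
by rewrite big_set1 /wsum big_set1 /wdeg big_set1 cxx addr0.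
Qed.

Lemma wtD1 v U : v \in U -> wsum U = wsum (U :\ v) + 2 * wdeg v U.
Proof. by move=> vU; rewrite -[in LHS](setD1K vU) wtU1 ?deg_self // setD11. Qed.

Lemma wt_split U Z : Z \subset U ->
  wsum U = wsum Z + wsum (U :\: Z) + 2 * \sum_(v in U :\: Z) wdeg v Z.
Proof.
move=> ZU; rewrite -wtU; last by rewrite disjoint_sym disjoints_subset setDE subsetIr.
by rewrite -{1}(setIidPr ZU) setID.
Qed.

(** A pair inside [U] survives the removal of any vertex of [U] but its own two. *)
Lemma wt_average U : \sum_(x in U) wsum (U :\ x) = #|U|%:R * wsum U - 2 * wsum U.
Proof.
rewrite (eq_bigr (fun x => wsum U - 2 * wdeg x U)); last first.
  by move=> x xU; rewrite [wsum U](wtD1 xU) addrK.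
by rewrite sumrB sumr_const -mulr_sumr -[wsum U *+ _]mulr_natl.
Qed.

Definition min_subset (k : nat) U Z :=
  [/\ Z \subset U, #|Z| = k & forall Q, Q \subset U -> #|Q| = k -> wsum Z <= wsum Q].

Lemma ex_min_subset k U : (k <= #|U|)%N -> exists Z, min_subset k U Z.
Proof.
move=> /exists_subset[Z0 Z0U Z0k].
pose P Z := (Z \subset U) && (#|Z| == k).
have P0 : P Z0 by rewrite /P Z0U Z0k eqxx.
case: (Order.TotalTheory.arg_minP wsum P0) => Z /andP[ZU /eqP Zk] minZ.
by exists Z; split=> // Q QU Qk; apply: minZ; rewrite /P QU Qk eqxx.
Qed.

(** Exchanging [x] for [v] cannot give a set lighter than [Z], and the two weights differ by twice
    the difference of these degrees. *)
Lemma min_subset_deg k U Z v x : min_subset k U Z -> v \in U :\: Z ->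
  x \in v |: Z -> wdeg x (v |: Z) <= wdeg v Z.
Proof.
move=> [ZU Zk minZ]; rewrite inE => /andP[vZ vU] xZ.
have := minZ ((v |: Z) :\ x).
rewrite subDset subsetU ?(subUset, sub1set) ?vU ?ZU ?orbT // => /(_ isT).
have -> : #|(v |: Z) :\ x| = k.
  by have := cardsD1 x (v |: Z); rewrite xZ cardsU1 vZ Zk => -[].
have := wtU1 vZ; rewrite (wtD1 xZ) => E /(_ erefl); lra.
Qed.

End Weights.

(** * Goodman's count of monochromatic triangles *)

Section Goodman.
Variables (V : finType) (col : rel V).
Hypothesis symcol : symmetric col.
Implicit Types (x y z v p q : V) (U Z S A B Q : {set V}).
Local Open Scope nat_scope.

Definition dist3 x y z := [&& x != y, y != z & x != z].
Definition mono x y z := dist3 x y z && ((col x y == col y z) && (col y z == col x z)).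
Definition vee x y z := dist3 x y z && (col x y == col x z).

Lemma mono_rot x y z : mono x y z = mono y z x.
Proof.
rewrite /mono /dist3 !(eq_sym y x) !(eq_sym z x) (symcol y x) (symcol z x).
by case: (x != y); case: (y != z); case: (x != z); case: (col x y); case: (col y z);
  case: (col x z).
Qed.

Lemma mono_swap x y z : mono x y z = mono y x z.
Proof.
rewrite /mono /dist3 (eq_sym y x) (symcol y x).
by case: (x != y); case: (y != z); case: (x != z); case: (col x y); case: (col y z);
  case: (col x z).
Qed.

(** A triangle has three monochromatic angles if it is monochromatic and exactly one otherwise;
    [vee] detects the angle at its first argument. *)
Lemma goodman_pointwise x y z :
  2 * mono x y z + dist3 x y z = vee x y z + vee y x z + vee z x y.
Proof.
rewrite /mono /vee /dist3 (symcol y x) (symcol z x) (symcol z y).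
rewrite !(eq_sym y x) !(eq_sym z x) !(eq_sym z y).
by case: (x != y); case: (y != z); case: (x != z); case: (col x y); case: (col y z);
  case: (col x z).
Qed.

Lemma sum_pred_card (T : finType) (A : {set T}) (P : pred T) :
  \sum_(x in A) P x = #|[set x in A | P x]|.
Proof. by rewrite -sum1dep_card big_mkcondr; apply: eq_bigr => x _; case: (P x). Qed.

Lemma sum_dist3 S : \sum_(x in S) \sum_(y in S) \sum_(z in S) dist3 x y z =
  #|S| * (#|S|.-1 * #|S|.-2).
Proof.
rewrite -sum_nat_const; apply: eq_bigr => x xS.
rewrite (big_setD1 x) //= [X in X + _]big1 => [|z _]; last by rewrite /dist3 eqxx.
have cSx : #|S :\ x| = #|S|.-1 by rewrite (cardsD1 x S) xS.
rewrite -{1}cSx -sum_nat_const; apply: eq_bigr => y yS.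
rewrite sum_pred_card.
have -> : [set z in S | dist3 x y z] = S :\ x :\ y.
  apply/setP => z; move: yS; rewrite !inE /dist3 (eq_sym y x) => /andP[-> _] /=.
  by rewrite (eq_sym y) (eq_sym x) andbC -andbA.
by have := cardsD1 y (S :\ x); rewrite yS cSx => ->.
Qed.

Lemma sum_vee S x : x \in S -> let r := #|[set y in S :\ x | col x y]| in
  let b := #|[set y in S :\ x | ~~ col x y]| in
  \sum_(y in S) \sum_(z in S) vee x y z = r * r.-1 + b * b.-1 /\ r + b = #|S|.-1.
Proof.
move=> xS r b; split; last first.
  have -> : #|S|.-1 = #|S :\ x| by rewrite (cardsD1 x S) xS.
  rewrite -(cardsID [set y | col x y] (S :\ x)).
  by congr (_ + _); apply: eq_card => y; rewrite !inE // andbC.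
rewrite (big_setD1 x) //= [X in X + _]big1 ?add0n => [|z _]; last by rewrite /vee /dist3 eqxx.
rewrite (bigID (col x)) /=; congr (_ + _).
  rewrite /r -sum_nat_const; apply: eq_big => [y|y /andP[yS cy]]; first by rewrite inE.
  rewrite sum_pred_card (cardsD1 y [set y in S :\ x | col x y]) inE yS cy /=.
  apply: eq_card => z; rewrite !inE /vee /dist3 cy; move: yS; rewrite !inE.
  move=> /andP[/negPf yx _]; rewrite (eq_sym x y) yx (eq_sym y z) (eq_sym x z).
  by case: (z == y); case: (z == x); case: (z \in S); case: (col x z).
rewrite /b -sum_nat_const; apply: eq_big => [y|y /andP[yS cy]]; first by rewrite inE.
rewrite sum_pred_card (cardsD1 y [set y in S :\ x | ~~ col x y]) inE yS cy /=.
apply: eq_card => z; rewrite !inE /vee /dist3 (negPf cy); move: yS; rewrite !inE.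
move=> /andP[/negPf yx _]; rewrite (eq_sym x y) yx (eq_sym y z) (eq_sym x z).
by case: (z == y); case: (z == x); case: (z \in S); case: (col x z).
Qed.

(** Here [k] bounds from below the ordered monochromatic angles at a vertex. Summing
    [goodman_pointwise] over ordered triples counts all of them three times. *)
Lemma goodman S (k : nat) :
  (forall r b, r + b = #|S|.-1 -> k <= r * r.-1 + b * b.-1) ->
  3 * (#|S| * k) <= 2 * (\sum_(x in S) \sum_(y in S) \sum_(z in S) mono x y z) +
     #|S| * (#|S|.-1 * #|S|.-2).
Proof.
move=> Hk.
have HV : #|S| * k <= \sum_(x in S) \sum_(y in S) \sum_(z in S) vee x y z.
  rewrite -sum_nat_const; apply: leq_sum => x xS.
  by have [-> /Hk] := sum_vee xS.
have V2 : \sum_(x in S) \sum_(y in S) \sum_(z in S) vee y x z =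
    \sum_(x in S) \sum_(y in S) \sum_(z in S) vee x y z.
  exact: exchange_big.
have V3 : \sum_(x in S) \sum_(y in S) \sum_(z in S) vee z x y =
    \sum_(x in S) \sum_(y in S) \sum_(z in S) vee x y z.
  rewrite (eq_bigr (fun x => \sum_(z in S) \sum_(y in S) vee z x y)) => [|x _].
    by rewrite exchange_big.
  by rewrite exchange_big.
rewrite -sum_dist3 big_distrr -big_split /=.
rewrite (eq_bigr (fun x => \sum_(y in S) \sum_(z in S) vee x y z +
  \sum_(y in S) \sum_(z in S) vee y x z + \sum_(y in S) \sum_(z in S) vee z x y)).
  by rewrite !big_split /= V2 V3; lia.
move=> x _; rewrite big_distrr -!big_split; apply: eq_bigr => y _ /=.
by rewrite big_distrr -!big_split; apply: eq_bigr => z _ /=; rewrite goodman_pointwise.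
Qed.

End Goodman.

(** * Lower bounds for covers *)

Lemma sum3_rot (T : finType) (R : nmodType) (S : {set T}) (F : T -> T -> T -> R) :
  \sum_(x in S) \sum_(y in S) \sum_(z in S) F x y z =
  \sum_(x in S) \sum_(y in S) \sum_(z in S) F z x y.
Proof.
rewrite exchange_big /=.
rewrite [RHS](eq_bigr (fun x => \sum_(z in S) \sum_(y in S) F z x y)) => [|x _].
  by rewrite [RHS]exchange_big /= exchange_big.
exact: exchange_big.
Qed.

(* [tau m] is [4 * floor ((m - 1)^2 / 4)]. *)
Definition tau (R : pzRingType) (m : nat) : R := (m%:R - 1) ^+ 2 - (~~ odd m)%:R.

Section Cover.
Variables (V : finType) (R : realFieldType) (col : rel V) (c : V -> V -> R).
Hypothesis symcol : symmetric col.
Hypotheses (csym : forall x y, c x y = c y x) (c0 : forall x y, 0 <= c x y).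
Hypothesis (cxx : forall x, c x x = 0).
Hypothesis ccov : forall x y z, mono col x y z -> 1 <= c x y + c y z + c x z.
Implicit Types (x y z v p q : V) (U Z S A B Q P K : {set V}).
Local Notation deg := (wdeg c).
Local Notation wt := (wsum c).
Local Notation min_subset := (min_subset c).

(** Two monochromatic triangles on a common edge, a book in the usual sense, provide such vertices
    by [two_apexes]; what matters later is the degree condition. *)
Definition book S := exists p q, [/\ p \in S, q \in S, p != q & 2 <= deg p S + deg q S].

(** Adding the cover inequalities of the two triangles counts [c x y] twice and the four other edges
    once, all within the degrees of [x] and [y]. *)
Lemma two_apexes S x y z w : z != w -> x \in S -> y \in S -> z \in S -> w \in S ->
  mono col x y z -> mono col x y w -> book S.
Proof.
move=> zw xS yS zS wS mz mw.
have := ccov mz; have := ccov mw.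
move: mz mw => /andP[/and3P[xy yz xz] _] /andP[/and3P[_ yw xw] _] h1 h2.
exists x, y; split=> //.
have D a b : a \in S -> b \in S -> a != b -> z != b -> a != w -> a != z -> b != w ->
  c a b + c a z + c a w <= deg a S.
  move=> aS bS ab zb aw az bw.
  rewrite (degD1 c a bS) (@degD1 _ _ c a z) ?inE ?zS ?zb //.
  rewrite (@degD1 _ _ c a w) ?inE ?wS ?(eq_sym w) ?bw ?zw //.
  by have := deg_ge0 c0 a (S :\ b :\ z :\ w); lra.
have := D x y xS yS xy; rewrite (eq_sym z) => /(_ yz xw xz yw).
have := D y x yS xS; rewrite (eq_sym z) (eq_sym y x) => /(_ xy xz yw yz xw).
rewrite (csym y x); lra.
Qed.

(** Without a book the monochromatic triangles in [S] are edge-disjoint, so each has weight at least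
    1 of its own. Six ordered triples per triangle and the doubled weight give the factor 3. *)
Lemma goodman_weight S : ~ book S ->
  (\sum_(x in S) \sum_(y in S) \sum_(z in S) mono col x y z)%:R <= 3 * wt S.
Proof.
move=> nb.
have apex x y : x \in S -> y \in S -> (\sum_(z in S) mono col x y z <= 1)%N.
  move=> xS yS; rewrite sum_pred_card leqNgt; apply/negP => /card_gt1P[z [w [zS wS zw]]].
  move: zS wS; rewrite !inE => /andP[zS mz] /andP[wS mw].
  exact/nb/(two_apexes zw xS yS).
have apexw x y : x \in S -> y \in S ->
    \sum_(z in S) (mono col x y z)%:R * c x y <= c x y.
  move=> xS yS; rewrite -mulr_suml -natr_sum ler_piMl // lern1; exact: apex.
pose T := \sum_(x in S) \sum_(y in S) \sum_(z in S) (mono col x y z)%:R * c x y.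
have T3 : T <= wt S.
  apply: ler_sum => x xS; apply: ler_sum => y yS; exact: apexw.
apply: le_trans (ler_wpM2l (ler0n _ 3) T3); rewrite natr_sum.
have -> : 3%:R * T = T + T + T by ring.
have E1 : T = \sum_(x in S) \sum_(y in S) \sum_(z in S) (mono col z x y)%:R * c z x.
  exact: sum3_rot.
have E2 : T = \sum_(x in S) \sum_(y in S) \sum_(z in S) (mono col y z x)%:R * c y z.
  by rewrite E1 sum3_rot.
rewrite {2}E2 {2}E1 /T -!big_split /=.
apply: ler_sum => x _; rewrite natr_sum -!big_split /=.
apply: ler_sum => y _; rewrite natr_sum -!big_split /=.
apply: ler_sum => z _; rewrite -(mono_rot symcol y z x) -(mono_rot symcol x y z).
have [m|m] := boolP (mono col x y z); last by rewrite !mul0r !addr0.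
by rewrite !mul1r (csym z x) /=; have := ccov m; lra.
Qed.

(** Five edges at a vertex split at best as 3 + 2, which gives 8 ordered angles; Goodman's bound
    then yields 12 ordered triples, that is two triangles. *)
Lemma good6 S : #|S| = 6 -> book S \/ 4 <= wt S.
Proof.
move=> S6; have [|nb] := pselect (book S); [by left | right].
have := goodman_weight nb.
have : (3 * (#|S| * 8) <= 2 * (\sum_(x in S) \sum_(y in S) \sum_(z in S) mono col x y z) +
     #|S| * (#|S|.-1 * #|S|.-2))%N.
  by apply: goodman => // r b; rewrite S6; case: r => [|[|[|[|[|[|]]]]]] /=; lia.
rewrite S6; move: (\sum_(x in S) _)%N => M h Mw.
have : 12%:R <= M%:R :> R by rewrite ler_nat; lia.
lra.
Qed.

(** Six edges at a vertex split at best as 3 + 3, which gives 12 ordered angles and at least 21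
    ordered triples. *)
Lemma good7 S : #|S| = 7 -> book S \/ 7 <= wt S.
Proof.
move=> S7; have [|nb] := pselect (book S); [by left | right].
have := goodman_weight nb.
have : (3 * (#|S| * 12) <= 2 * (\sum_(x in S) \sum_(y in S) \sum_(z in S) mono col x y z) +
     #|S| * (#|S|.-1 * #|S|.-2))%N.
  by apply: goodman => // r b; rewrite S7; case: r => [|[|[|[|[|[|[|]]]]]]] /=; lia.
rewrite S7; move: (\sum_(x in S) _)%N => M h Mw.
have : 21%:R <= M%:R :> R by rewrite ler_nat; lia.
lra.
Qed.

(** * Removing light 5-sets and lightest 6-sets *)

Definition heavy5 U := forall Q, Q \subset U -> #|Q| = 5 -> 2 <= wt Q.

Lemma heavy5_sub A B : A \subset B -> heavy5 B -> heavy5 A.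
Proof. by move=> AB hB Q QA; apply: hB; exact: subset_trans AB. Qed.

(** For a book [p], [q] both [S :\ p] and [S :\ q] weigh at least 2; adding twice the degrees back,
    the two expressions for [wt S] sum to at least 8. *)
Lemma heavy6 U S : heavy5 U -> S \subset U -> #|S| = 6 -> 4 <= wt S.
Proof.
move=> hU SU S6; have [[p [q [pS qS _ pq]]]|//] := good6 S6.
have c5 x : x \in S -> 2 <= wt (S :\ x).
  move=> xS; apply: hU; first exact: subset_trans (subsetDl _ _) SU.
  by have := cardsD1 x S; rewrite xS S6 => -[].
have := c5 p pS; have := c5 q qS.
have := wtD1 csym cxx pS; have := wtD1 csym cxx qS; lra.
Qed.

(** If [v |: Z] has a book, the exchange argument bounds both of its degrees by [deg v Z]; otherwise
    [v |: Z] weighs at least 4 while [Z] weighs at most 2. *)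
Lemma light_deg U Z v : min_subset 5 U Z -> wt Z <= 2 -> v \in U :\: Z -> 1 <= deg v Z.
Proof.
move=> mZ Z2 vUZ; have [_ Z5 _] := mZ; have /setDP[_ vZ] := vUZ.
have S6 : #|v |: Z| = 6 by rewrite cardsU1 vZ Z5.
have [[p [q [pS qS _]]]|] := good6 S6.
  have := min_subset_deg csym cxx mZ vUZ pS.
  by have := min_subset_deg csym cxx mZ vUZ qS; lra.
by rewrite wtU1 //; lra.
Qed.

(** As for [light_deg], but without a book the seven degrees in [v |: Z] sum to at least 7 and none
    exceeds [deg v Z]. *)
Lemma heavy_deg U Z v : min_subset 6 U Z -> v \in U :\: Z -> 1 <= deg v Z.
Proof.
move=> mZ vUZ; have [_ Z6 _] := mZ; have /setDP[_ vZ] := vUZ.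
have S7 : #|v |: Z| = 7 by rewrite cardsU1 vZ Z6.
have [[p [q [pS qS _]]]|] := good7 S7.
  have := min_subset_deg csym cxx mZ vUZ pS.
  by have := min_subset_deg csym cxx mZ vUZ qS; lra.
have : wt (v |: Z) <= \sum_(x in v |: Z) deg v Z.
  by apply: ler_sum => x xS; exact: min_subset_deg mZ vUZ xS.
by rewrite sumr_const S7 -mulr_natl; lra.
Qed.

Lemma sum_deg_ge U Z : Z \subset U -> (forall v, v \in U :\: Z -> 1 <= deg v Z) ->
  #|U|%:R - #|Z|%:R <= \sum_(v in U :\: Z) deg v Z.
Proof.
move=> ZU h; have -> : #|U|%:R - #|Z|%:R = \sum_(v in U :\: Z) (1 : R).
  by rewrite sumr_const cardsDS // natrB // subset_leq_card.
exact: ler_sum.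
Qed.

Lemma light_step U Z : min_subset 5 U Z -> wt Z <= 2 ->
  wt (U :\: Z) + 2 * (#|U|%:R - 5) <= wt U.
Proof.
move=> mZ Z2; have [ZU Z5 _] := mZ.
have := sum_deg_ge ZU (fun v => light_deg mZ Z2).
by rewrite (wt_split csym ZU) Z5; have := wt_ge0 c0 Z; lra.
Qed.

Lemma heavy_step U Z : min_subset 6 U Z ->
  wt (U :\: Z) + wt Z + 2 * (#|U|%:R - 6) <= wt U.
Proof.
move=> mZ; have [ZU Z6 _] := mZ.
have := sum_deg_ge ZU (fun v => heavy_deg mZ (v := v)).
by rewrite (wt_split csym ZU) Z6; lra.
Qed.

(** From m to m - 6 the polynomial drops by 12 (m - 4), exactly six times the weight
    [4 + 2 * (m - 6)] removed with a lightest 6-set; it is at most 0 for m <= 4. *)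
Lemma heavy_bound U : heavy5 U -> (#|U|%:R - 4) * (#|U|%:R + 2) <= 6 * wt U.
Proof.
have [k] := ubnP #|U|; elim: k U => // k IH U /ltnSE kU hU.
have [U6|U6] := leqP 6 #|U|.
  have [Z mZ] := ex_min_subset c U6; have [ZU Z6 _] := mZ.
  have := heavy_step mZ; have := heavy6 hU ZU Z6.
  have cUZ : #|U :\: Z|%:R = #|U|%:R - 6 :> R by rewrite cardsDS // Z6 natrB.
  have := IH (U :\: Z); rewrite cUZ cardsDS // Z6.
  have h : (#|U| - 6 < k)%N by lia.
  move=> /(_ h (heavy5_sub (subsetDl _ _) hU)); nra.
have := wt_ge0 c0 U; move: U6; rewrite ltnS leq_eqVlt => /orP[/eqP U5|U4].
  by have := hU U (subxx _) U5; rewrite U5; lra.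
by case: #|U| U4 => [|[|[|[|[|]]]]] // _ ?; lra.
Qed.

Lemma light_or_heavy U : (exists2 Z, min_subset 5 U Z & wt Z <= 2) \/ heavy5 U.
Proof.
have [U5|U5] := leqP 5 #|U|; last first.
  by right => Q /subset_leq_card QU Q5; rewrite Q5 leqNgt U5 in QU.
have [Z mZ] := ex_min_subset c U5; have [Z2|Z2] := leP (wt Z) 2; first by left; exists Z.
right=> Q QU Q5; have [_ _ minZ] := mZ; have := minZ Q QU Q5; lra.
Qed.

Lemma linear_bound U : 2 * (#|U|%:R - 5) <= wt U.
Proof.
have [[Z mZ Z2]|/heavy_bound] := light_or_heavy U; last by have := sqr_ge0 (#|U|%:R - 7 : R); nra.
by have := light_step mZ Z2; have := wt_ge0 c0 (U :\: Z); lra.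
Qed.

Lemma quadratic_bound U : #|U|%:R ^+ 2 - 2 * #|U|%:R - 20 <= 6 * wt U.
Proof.
have [k] := ubnP #|U|; elim: k U => // k IH U /ltnSE kU.
have [[Z mZ Z2]|/heavy_bound] := light_or_heavy U; last by set m : R := #|U|%:R; nra.
have [ZU Z5 _] := mZ; have m5 : (5 <= #|U|)%N by rewrite -Z5 subset_leq_card.
have cUZ : #|U :\: Z|%:R = #|U|%:R - 5 :> R by rewrite cardsDS // Z5 natrB.
have := light_step mZ Z2; have := linear_bound (U :\: Z); rewrite cUZ.
have := wt_ge0 c0 (U :\: Z).
(* With m the size of [U], induction yields m^2 - 45, which suffices once 2m >= 25; below that,
   [linear_bound] is applied to the remainder. *)
have [m13|] := leqP 13 #|U|.
  have := IH (U :\: Z); rewrite cUZ cardsDS // Z5.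
  have h : (#|U| - 5 < k)%N by lia.
  have : 13%:R <= #|U|%:R :> R by rewrite ler_nat.
  move=> ? /(_ h); nra.
rewrite ltnS => m12.
have m5' : 5%:R <= #|U|%:R :> R by rewrite ler_nat.
have [m10|] := leqP #|U| 10.
  have m10' : #|U|%:R <= 10%:R :> R by rewrite ler_nat.
  nra.
move: m12; rewrite leq_eqVlt => /orP[/eqP->|]; first lra.
rewrite ltnS leq_eqVlt => /orP[/eqP->|]; first lra.
lia.
Qed.

(** One light step followed by the quadratic bound gives m^2 - 45, which exceeds (m - 1)^2 exactly
    from m = 24 on. *)
Lemma light_bound U Z : (24 <= #|U|)%N -> min_subset 5 U Z -> wt Z <= 2 ->
  (#|U|%:R - 1) ^+ 2 < 6 * wt U.
Proof.
move=> m24 mZ Z2; have [ZU Z5 _] := mZ.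
have := light_step mZ Z2; have := quadratic_bound (U :\: Z).
rewrite cardsDS // Z5 natrB; last by apply: leq_trans m24.
have : 24%:R <= #|U|%:R :> R by rewrite ler_nat.
nra.
Qed.

(** * Triangles inside a 6-set *)

Lemma wtD2 U a b : a \in U -> b \in U -> a != b ->
  wt (U :\ a :\ b) = wt U - 2 * deg a U - 2 * deg b U + 2 * c a b.
Proof.
move=> aU bU ab; have bUa : b \in U :\ a by rewrite !inE eq_sym ab.
have := wtD1 csym cxx aU; have := wtD1 csym cxx bUa; have := degD1 c b aU.
by rewrite (csym b a); lra.
Qed.

Lemma wt_seq6 Z a b d e f g : uniq [:: a; b; d; e; f; g] ->
  Z =i [:: a; b; d; e; f; g] ->
  wt Z = 2 * (c a b + c a d + c b d + (c e f + c e g + c f g) +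
    (c a e + c b f + c d g) + (c a f + c a g + c b e + c b g + c d e + c d f)).
Proof.
move=> us EZ.
have sZ (F : V -> R) : \sum_(x in Z) F x = \sum_(x <- [:: a; b; d; e; f; g]) F x.
  by rewrite [RHS]big_uniq; [apply: eq_bigl => x; rewrite EZ | exact: us].
rewrite /wsum sZ !big_cons big_nil /wdeg !sZ !big_cons !big_nil !cxx.
rewrite !(csym b a) !(csym d a) !(csym e a) !(csym f a) !(csym g a).
rewrite !(csym d b) !(csym e b) !(csym f b) !(csym g b).
rewrite !(csym e d) !(csym f d) !(csym g d) !(csym f e) !(csym g e) !(csym g f).
ring.
Qed.

(** Neither [e] nor [f] sends two edges of the triangle's colour to [a b d], so some vertex of it is
    joined to both in the other colour and closes a triangle with [e f]. The sequence [s] lists that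
    vertex first. *)
Lemma shared_triangles a b d e f g : mono col a b d ->
  uniq [:: a; b; d; e; f; g] -> col e f != col a b ->
  (forall x, x \in [:: e; f] -> ~ mono col a b x /\ ~ mono col b d x /\ ~ mono col a d x) ->
  exists s, [/\ perm_eq [:: a; b; d; e; f; g] s &
    match s with [:: a'; b'; d'; e'; f'; g'] => mono col a' b' d' /\ mono col a' e' f' | _ => False end].
Proof.
move=> mabd us nef H.
have := us; rewrite /= !inE !negb_or.
move=> /and5P[/and5P[ab ad ae af ag] /and4P[bd be bf bg] /and3P[de df dg] /andP[ef eg] _].
have [ab1 /andP[/eqP abd /eqP bdd]] := andP mabd.
have [nae [nbe nde]] := H e (mem_head _ _).
have [naf [nbf ndf]] := H f ltac:(by rewrite !inE eqxx orbT).
have mE x y z : x != y -> y != z -> x != z -> mono col x y z = (col x y == col y z) && (col y z == col x z).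
  by move=> xy yz xz; rewrite /mono /dist3 xy yz xz.
move: nae nbe nde naf nbf ndf; rewrite !mE // -bdd -abd => nae nbe nde naf nbf ndf.
have [h|h] := boolP ((col a e != col a b) && (col a f != col a b)).
  exists [:: a; b; d; e; f; g]; split=> //; split=> //; rewrite mE //.
  move: nef h; case: (col a b); case: (col e f); case: (col a e); case: (col a f) => //.
have [h'|h'] := boolP ((col b e != col a b) && (col b f != col a b)).
  exists [:: b; a; d; e; f; g]; split; first by apply/permP => P /=; ring.
  split; first by rewrite -(mono_swap symcol).
  rewrite mE //.
  move: nef h'; case: (col a b); case: (col e f); case: (col b e); case: (col b f) => //.
exists [:: d; a; b; e; f; g]; split; first by apply/permP => P /=; ring.
split; first by rewrite (mono_rot symcol).
rewrite mE //.
move: nef h h' nae nbe nde naf nbf ndf.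
by case: (col a b); case: (col e f); case: (col b e); case: (col b f); 
  case: (col a e); case: (col a f);  case: (col d e); case: (col d f) => //= ?????????; exfalso; auto.
Qed.

Lemma enum3 S : #|S| = 3 -> exists e f g, uniq [:: e; f; g] /\ S =i [:: e; f; g].
Proof.
rewrite cardE => S3; have := enum_uniq S; have := mem_enum S; move: S3.
case: (enum S) => [|e [|f [|g []]]] // _ m u.
by exists e, f, g; split=> // x; rewrite m.
Qed.

(** The Ramsey bound R(3, 3) <= 6, read off from Goodman's count. *)
Lemma ex_mono Z : #|Z| = 6 ->
  exists a b d, [/\ a \in Z, b \in Z, d \in Z & mono col a b d].
Proof.
move=> Z6; apply: contrapT => no.
have M0 : (\sum_(x in Z) \sum_(y in Z) \sum_(z in Z) mono col x y z = 0)%N.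
  apply: big1 => a aZ; apply: big1 => b bZ; apply: big1 => d dZ.
  by apply/eqP; rewrite eqb0; apply/negP => m; apply: no; exists a, b, d.
have rb r b : (r + b = #|Z|.-1 -> 8 <= r * r.-1 + b * b.-1)%N.
  by rewrite Z6; case: r => [|[|[|[|[|[|]]]]]] /=; lia.
by have := goodman symcol rb; rewrite M0 Z6.
Qed.

(* Goodman's bound provides one monochromatic triangle; in the absence of a
   book each outside vertex has at most one neighbour of its colour on it, so
   an outside pair of the other colour closes a second triangle. *)
Lemma two_triangles Z : #|Z| = 6 -> ~ book Z -> exists a b d e f g,
  [/\ uniq [:: a; b; d; e; f; g], Z =i [:: a; b; d; e; f; g], mono col a b d &
      mono col e f g \/ mono col a e f].
Proof.
move=> Z6 nb.
have [a [b [d [aZ bZ dZ mabd]]]] := ex_mono Z6.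
have [/and3P[ab bd ad] _] := andP mabd.
have sT : [set a; b; d] \subset Z by rewrite !subUset !sub1set aZ bZ dZ.
have T3 : #|[set a; b; d]| = 3 by rewrite -setUA cardsU1 cards2 !inE negb_or ab ad bd.
have [e [f [g [u3 E3]]]] : exists e f g, uniq [:: e; f; g] /\ Z :\: [set a; b; d] =i [:: e; f; g].
  by apply: enum3; rewrite cardsDS // T3 Z6.
have out x : x \in [:: e; f; g] -> [/\ x \in Z, x != a, x != b & x != d].
  by rewrite -E3 !inE !negb_or => /andP[/andP[/andP[-> ->] ->] ->].
have [eZ ea eb ed] := out e ltac:(by rewrite !inE eqxx).
have [fZ fa fb fd] := out f ltac:(by rewrite !inE eqxx !orbT).
have [gZ ga gb gd] := out g ltac:(by rewrite !inE eqxx !orbT).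
have us : uniq [:: a; b; d; e; f; g].
  move: u3; rewrite /= !inE !negb_or ab ad bd !(eq_sym a) !(eq_sym b) !(eq_sym d).
  by rewrite ea eb ed fa fb fd ga gb gd.
have EZ : Z =i [:: a; b; d; e; f; g].
  move=> x; have := E3 x; rewrite !inE.
  have [->|_] := eqVneq x a; first by rewrite aZ.
  have [->|_] := eqVneq x b; first by rewrite bZ.
  by have [->|_] := eqVneq x d; first by rewrite dZ.
have nm x : x \in [:: e; f; g] -> ~ mono col a b x /\ ~ mono col b d x /\ ~ mono col a d x.
  move=> /out[xZ xa xb xd]; split; first by move=> m; apply: nb; apply: (two_apexes _ aZ bZ dZ xZ) => //; rewrite eq_sym.
  split; move=> m; apply: nb.
    apply: (two_apexes _ bZ dZ aZ xZ _ m); first by rewrite eq_sym.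
    by rewrite -(mono_rot symcol a).
  apply: (two_apexes _ aZ dZ bZ xZ _ m); first by rewrite eq_sym.
  by rewrite (mono_swap symcol) (mono_rot symcol).
have fin s : (exists s', [/\ perm_eq s s' &
    match s' with [:: a'; b'; d'; e'; f'; g'] => mono col a' b' d' /\ mono col a' e' f'
     | _ => False end]) -> perm_eq [:: a; b; d; e; f; g] s ->
  exists a b d e f g,
  [/\ uniq [:: a; b; d; e; f; g], Z =i [:: a; b; d; e; f; g], mono col a b d &
      mono col e f g \/ mono col a e f].
  case=> s' [ps']; case: s' ps' => [|a' [|b' [|d' [|e' [|f' [|g' []]]]]]] // ps' [m1 m2] ps.
  exists a', b', d', e', f', g'; split=> //; last by right.
    by rewrite -(perm_uniq ps') -(perm_uniq ps).
  by move=> x; rewrite EZ (perm_mem ps) (perm_mem ps').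
have [h1|h1] := boolP (col e f == col a b); last first.
  apply: (fin _ (shared_triangles mabd us h1 _)) => // x hx.
  by apply: nm; move: hx; rewrite !inE => /orP[]->; rewrite ?orbT.
have [h2|h2] := boolP (col e g == col a b); last first.
  have p2 : perm_eq [:: a; b; d; e; f; g] [:: a; b; d; e; g; f] by apply/permP => P /=; ring.
  have u2 := us; rewrite (perm_uniq p2) in u2.
  apply: (fin _ (shared_triangles mabd u2 h2 _)) => //.
  by move=> x hx; apply: nm; move: hx; rewrite !inE => /orP[]->; rewrite ?orbT.
have [h3|h3] := boolP (col f g == col a b); last first.
  have p3 : perm_eq [:: a; b; d; e; f; g] [:: a; b; d; f; g; e] by apply/permP => P /=; ring.
  have u4 := us; rewrite (perm_uniq p3) in u4.
  apply: (fin _ (shared_triangles mabd u4 h3 _)) => //.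
  by move=> x hx; apply: nm; move: hx; rewrite !inE => /orP[]->; rewrite ?orbT.
exists a, b, d, e, f, g; split=> //; left.
move: u3; rewrite /= !inE negb_or !andbT => /andP[/andP[ef eg] fg].
by rewrite /mono /dist3 ef eg fg (eqP h1) (eqP h2) (eqP h3) !eqxx.
Qed.

(** * The exact bound, by residues modulo 6 *)

Lemma heavy_exact_mod012 U : heavy5 U -> (#|U| %% 6 < 3)%N -> tau R #|U| <= 6 * wt U.
Proof.
have [k] := ubnP #|U|; elim: k U => // k IH U /ltnSE kU hU U012.
have [U6|U6] := leqP 6 #|U|.
  have [Z mZ] := ex_min_subset c U6; have [ZU Z6 _] := mZ.
  have := heavy_step mZ.
  have := heavy6 hU ZU Z6.
  have cUZ : #|U :\: Z| = (#|U| - 6)%N by rewrite cardsDS // Z6.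
  have h1 : (#|U| - 6 < k)%N by lia.
  have h2 : ((#|U| - 6) %% 6 < 3)%N by lia.
  have h3 : odd (#|U| - 6) = odd #|U| by lia.
  have := IH (U :\: Z); rewrite cUZ => /(_ h1 (heavy5_sub (subsetDl _ _) hU) h2).
  rewrite /tau h3 natrB //; nra.
(* [tau] vanishes at 0, 1 and 2, and above that each removal of six vertices matched its decrease 12
   (m - 4). *)
have := wt_ge0 c0 U; case: #|U| U6 U012 => [|[|[|[|[|[|]]]]]] //= _ _; rewrite /tau /=; lra.
Qed.

Lemma average_step U (K : R) : (forall x, x \in U -> K <= 6 * wt (U :\ x)) ->
  #|U|%:R * K <= (#|U|%:R - 2) * (6 * wt U).
Proof.
move=> h; have -> : (#|U|%:R - 2) * (6 * wt U) = \sum_(x in U) 6 * wt (U :\ x).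
  by rewrite -mulr_sumr (wt_average csym cxx); ring.
have -> : #|U|%:R * K = \sum_(x in U) K by rewrite sumr_const -[RHS]mulr_natl.
exact: ler_sum.
Qed.

Lemma wt_pairs S Z : Z \subset S ->
  \sum_(a in Z) \sum_(b in Z :\ a) wt (S :\ a :\ b) =
  #|Z|%:R * (#|Z|%:R - 1) * wt S - 4 * (#|Z|%:R - 1) * \sum_(a in Z) deg a S + 2 * wt Z.
Proof.
move=> ZS; set D := \sum_(a in Z) deg a S.
transitivity (\sum_(a in Z) ((#|Z|%:R - 1) * wt S - 2 * (#|Z|%:R - 1) * deg a S
  - 2 * (D - deg a S) + 2 * deg a Z)).
  apply: eq_bigr => a aZ; have aS := subsetP ZS a aZ.
  rewrite (eq_bigr (fun b => wt S - 2 * deg a S - 2 * deg b S + 2 * c a b)); last first.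
    move=> b; rewrite !inE => /andP[ba bZ].
    by rewrite (wtD2) // ?(subsetP ZS) // eq_sym.
  rewrite big_split sumrB sumr_const /= -!mulr_sumr.
  have -> : \sum_(b in Z :\ a) c a b = deg a Z by rewrite -(deg_self cxx).
  have -> : \sum_(b in Z :\ a) deg b S = D - deg a S.
    by rewrite /D (big_setD1 a aZ) /= addrC addrK.
  have -> : #|Z :\ a| = #|Z|.-1 by rewrite (cardsD1 a Z) aZ.
  rewrite -[X in X - _ + _]mulr_natr -subn1 natrB; last first.
    by rewrite card_gt0; apply/set0Pn; exists a.
  ring.
have sc (K : R) : \sum_(a in Z) K = #|Z|%:R * K by rewrite sumr_const mulr_natl.
rewrite !big_split /= !sumrN -!mulr_sumr !sc sumrB sc -/D -/(wt Z); ring.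
Qed.

Lemma deg_outside U Z : Z \subset U ->
  \sum_(a in Z) deg a U = wt Z + \sum_(v in U :\: Z) deg v Z.
Proof.
move=> ZU; rewrite /wsum (deg_exchange csym (U :\: Z)) -big_split /=.
apply: eq_bigr => a _; rewrite -degU //.
  by rewrite -{1}(setIidPr ZU) setID.
by rewrite disjoint_sym disjoints_subset setDE subsetIr.
Qed.

(** The loss of 8/5 arises at nine vertices and is carried unchanged through the removal of lightest
    6-sets. *)
Lemma heavy_mod3 U : heavy5 U -> (9 <= #|U|)%N -> (#|U| %% 6 = 3)%N ->
  5 * tau R #|U| - 8 <= 30 * wt U.
Proof.
have [k] := ubnP #|U|; elim: k U => // k IH U /ltnSE kU hU U9 U3.
have [Z mZ] := ex_min_subset c (leq_trans (isT : 6 <= 9)%N U9); have [ZU Z6 _] := mZ.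
have st := heavy_step mZ.
have wZ := heavy6 hU ZU Z6.
have cUZ : #|U :\: Z| = (#|U| - 6)%N by rewrite cardsDS // Z6.
have [U15|U15] := leqP 15 #|U|.
  have h1 : (#|U| - 6 < k)%N by lia.
  have h2 : (9 <= #|U| - 6)%N by lia.
  have h4 : ((#|U| - 6) %% 6 = 3)%N by lia.
  have h3 : odd (#|U| - 6) = odd #|U| by lia.
  have := IH (U :\: Z); rewrite cUZ => /(_ h1 (heavy5_sub (subsetDl _ _) hU) h2 h4).
  rewrite /tau h3 natrB //; first by nra.
  by lia.
have E9 : #|U| = 9 by lia.
(* Each of the 30 ordered pairs in [Z] leaves a 7-set, which weighs at least 6 by the exact bound
   for residue 1. *)
have : \sum_(a in Z) \sum_(b in Z :\ a) (6 : R) <=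
    \sum_(a in Z) \sum_(b in Z :\ a) wt (U :\ a :\ b).
  apply: ler_sum => a aZ; apply: ler_sum => b; rewrite inE => bZ.
  have aU := subsetP ZU a aZ; have /andP[ba bZ'] := bZ; rewrite inE in ba.
  have bU := subsetP ZU b bZ'.
  have c7 : #|U :\ a :\ b| = 7.
    have := cardsD1 a U; rewrite aU E9 add1n => -[E8].
    by have := cardsD1 b (U :\ a); rewrite !inE ba bU -E8 add1n => -[].
  have := @heavy_exact_mod012 (U :\ a :\ b).
  rewrite c7 /tau /= => H.
  have := H (heavy5_sub (subset_trans (subsetDl _ _) (subsetDl _ _)) hU) isT; lra.
rewrite wt_pairs // deg_outside // Z6.
have -> : \sum_(a in Z) \sum_(b in Z :\ a) (6 : R) = 180.
  rewrite (eq_bigr (fun=> 30)) => [|a aZ].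
    by rewrite sumr_const Z6 -mulr_natl; ring.
  have -> : \sum_(b in Z :\ a) (6 : R) = 6 *+ #|Z :\ a| by rewrite sumr_const.
  have -> : #|Z :\ a| = 5 by have := cardsD1 a Z; rewrite aZ Z6; lia.
  by rewrite -mulr_natl; ring.
move: st; rewrite [wt U](wt_split csym ZU) E9 /tau /=; set X := \sum_(v in _) _.
lra.
Qed.

Lemma heavy_mod4 U : heavy5 U -> (10 <= #|U|)%N -> (#|U| %% 6 = 4)%N ->
  #|U|%:R * (5 * tau R #|U|.-1 - 8) <= (#|U|%:R - 2) * (30 * wt U).
Proof.
move=> hU U10 U4.
have := @average_step U ((5 * tau R #|U|.-1 - 8) / 5).
have h x : x \in U -> (5 * tau R #|U|.-1 - 8) / 5 <= 6 * wt (U :\ x).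
  move=> xU; have E : #|U :\ x| = #|U|.-1 by rewrite (cardsD1 x U) xU.
  have := @heavy_mod3 (U :\ x) (heavy5_sub (subsetDl _ _) hU); rewrite E.
  have e1 : (9 <= #|U|.-1)%N by lia.
  have e2 : (#|U|.-1 %% 6 = 3)%N by lia.
  by move=> /(_ e1 e2); lra.
move=> /(_ h); lra.
Qed.

(** [Z] has two edge-disjoint monochromatic triangles of weight at least 1 each, and the matching
    avoids the edges of both. *)
Lemma matching Z : #|Z| = 6 -> (forall z, z \in Z -> deg z Z < 1) ->
  exists a b d e f g, [/\ uniq [:: a; b; d; e; f; g], Z =i [:: a; b; d; e; f; g] &
    2 * (c a b + c d e + c f g) <= wt Z - 4].
Proof.
move=> Z6 d1; have nb : ~ book Z.
  by move=> [p [q [/d1 ? /d1 ? _]]]; lra.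
have [a [b [d [e [f [g [us EZ m1 m2]]]]]]] := two_triangles Z6 nb.
have w := wt_seq6 us EZ.
have w1 := ccov m1.
have := (c0 a e, c0 a f, c0 a g, c0 b e, c0 b f, c0 b g, c0 d e, c0 d f, c0 d g).
move=> [[[[[[[[w2 w3] w4] w5] w6] w7] w8] w9] w10].
have := (c0 e f, c0 e g, c0 f g) => -[[w11 w12] w13].
case: m2 => /ccov w14.
  have p : perm_eq [:: a; b; d; e; f; g] [:: a; e; b; f; d; g] by apply/permP => P /=; ring.
  exists a, e, b, f, d, g; split; last by lra.
  - by rewrite -(perm_uniq p).
  - by move=> x; rewrite EZ (perm_mem p).
have p : perm_eq [:: a; b; d; e; f; g] [:: a; g; b; e; d; f] by apply/permP => P /=; ring.
exists a, g, b, e, d, f; split; last by lra.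
- by rewrite -(perm_uniq p).
- by move=> x; rewrite EZ (perm_mem p).
Qed.

(** Add [H] over the three pairs of a light matching: the degrees of [Z] sum to [wt Z] plus at least
    m - 6, twice the matching weighs at most [wt Z - 4], and the average gain is 4m - 8, the
    difference of [tau] at m and m - 2. *)
Lemma matching_step U Z : min_subset 6 U Z -> (forall z, z \in Z -> deg z Z < 1) ->
  (forall a b, a \in U -> b \in U -> a != b -> tau R (#|U| - 2) <= 6 * wt (U :\ a :\ b)) ->
  heavy5 U -> tau R #|U| <= 6 * wt U.
Proof.
move=> mZ d1 H hU; have [ZU Z6 _] := mZ.
have [a [b [d [e [f [g [us EZ M]]]]]]] := matching Z6 d1.
have U6 : (6 <= #|U|)%N by rewrite -Z6 subset_leq_card.
have inU x : x \in [:: a; b; d; e; f; g] -> x \in U by rewrite -EZ; exact: (subsetP ZU).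
have [aU bU dU] : [/\ a \in U, b \in U & d \in U].
  by split; apply: inU; rewrite !inE eqxx ?orbT.
have [eU fU gU] : [/\ e \in U, f \in U & g \in U].
  by split; apply: inU; rewrite !inE eqxx ?orbT.
have [ab de fg] : [/\ a != b, d != e & f != g].
  by move: us; rewrite /= !inE !negb_or => /and5P[/and5P[-> _ _ _ _] _ /and3P[-> _ _] /andP[_ _] /andP[]]; split.
have := H a b aU bU ab; have := H d e dU eU de; have := H f g fU gU fg.
rewrite !(wtD2) //.
have : \sum_(x in Z) deg x U = deg a U + deg b U + deg d U + deg e U + deg f U + deg g U.
  transitivity (\sum_(x <- [:: a; b; d; e; f; g]) deg x U).
    by rewrite [RHS]big_uniq; [apply: eq_bigl => x; rewrite EZ | exact: us].
  by rewrite !big_cons big_nil; ring.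
rewrite deg_outside //.
have := sum_deg_ge ZU (fun v => heavy_deg mZ (v := v)).
have := heavy6 hU ZU Z6.
have o : odd (#|U| - 2) = odd #|U| by rewrite oddB ?addbF // (leq_trans _ U6).
rewrite /tau o natrB ?(leq_trans _ U6) // Z6.
rewrite [wt U](wt_split csym ZU); have := wt_ge0 c0 (U :\: Z); set X := \sum_(v in _) _.
nra.
Qed.

Lemma cardsD1_pred U x : x \in U -> #|U :\ x| = #|U|.-1.
Proof. by move=> xU; rewrite (cardsD1 x U) xU. Qed.

Lemma cardsD2 U a b : a \in U -> b \in U -> a != b -> #|U :\ a :\ b| = (#|U| - 2)%N.
Proof.
by move=> aU bU ab; rewrite !cardsD1_pred ?inE ?(eq_sym b) ?ab // -subn2.
Qed.

Lemma exact_removing2 U a b : heavy5 U -> a \in U -> b \in U -> a != b ->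
  ((#|U| - 2) %% 6 < 3)%N -> tau R (#|U| - 2) <= 6 * wt (U :\ a :\ b).
Proof.
move=> hU aU bU ab h; rewrite -(cardsD2 aU bU ab).
apply: (heavy_exact_mod012); last by rewrite cardsD2.
exact: heavy5_sub (subset_trans (subsetDl _ _) (subsetDl _ _)) hU.
Qed.

(** In a counterexample the near-exact bound for the remainder keeps a lightest 6-set barely above
    4. Its 5-subsets are too heavy for it to have a vertex of degree 1 or more, so [matching_step]
    applies. *)
Lemma heavy_exact_mod3 U : heavy5 U -> (21 <= #|U|)%N -> (#|U| %% 6 = 3)%N ->
  tau R #|U| <= 6 * wt U.
Proof.
move=> hU U21 U3; rewrite leNgt; apply/negP => lt.
have [Z mZ] := ex_min_subset c (leq_trans (isT : 6 <= 21)%N U21); have [ZU Z6 _] := mZ.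
have [Y mY] := ex_min_subset c (leq_trans (isT : 5 <= 21)%N U21); have [YU Y5 minY] := mY.
have U21R : 21%:R <= #|U|%:R :> R by rewrite ler_nat.
have oU : odd #|U| by clear -U21 U3; lia.
have wZ : 6 * wt Z < 24 + 8 / 5.
  have cUZ : #|U :\: Z| = (#|U| - 6)%N by rewrite cardsDS // Z6.
  have o6 : odd (#|U| - 6) by clear -U21 U3; lia.
  have h2 : (9 <= #|U| - 6)%N by clear -U21 U3; lia.
  have h4 : ((#|U| - 6) %% 6 = 3)%N by clear -U21 U3; lia.
  have := heavy_mod3 (heavy5_sub (subsetDl U Z) hU); rewrite cUZ => /(_ h2 h4).
  have := heavy_step mZ.
  have h5 : (6 <= #|U|)%N by apply: leq_trans U21.
  by move: lt; rewrite /tau oU o6 natrB //; nra.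
(* Otherwise [wt Y < 34 / 15]. Outside vertices have degree at least [2 - wt Y / 2] to [Y], as
   6-sets weigh at least 4, and the residue 4 bound on [U :\: Y] contradicts [lt] from size 16 on,
   hence from 21 in this residue class. *)
have wY : wt Z - 2 < wt Y.
  rewrite ltNge; apply/negP => YZ.
  have dY : (#|U|%:R - 5) * (2 - wt Y / 2) <= \sum_(v in U :\: Y) deg v Y.
    have -> : #|U|%:R - 5 = #|U :\: Y|%:R :> R.
      by rewrite cardsDS // Y5 natrB // (leq_trans _ U21).
    rewrite mulr_natl -sumr_const; apply: ler_sum => v /setDP[vU vY].
    have S6 : #|v |: Y| = 6 by rewrite cardsU1 vY Y5.
    have SU : v |: Y \subset U by rewrite subUset sub1set vU YU.
    have := heavy6 hU SU S6.
    by rewrite (wtU1 csym cxx vY); lra.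
  have cUY : #|U :\: Y| = (#|U| - 5)%N by rewrite cardsDS // Y5.
  have o5 : odd (#|U| - 5) = false by clear -U21 U3; lia.
  have o6 : odd (#|U| - 5).-1 by clear -U21 U3; lia.
  have h2 : (10 <= #|U| - 5)%N by clear -U21 U3; lia.
  have h4 : ((#|U| - 5) %% 6 = 4)%N by clear -U21 U3; lia.
  have h6 : (#|U| - 5).-1 = (#|U| - 6)%N by clear -U21 U3; lia.
  have h5 : (5 <= #|U|)%N by clear -U21 U3; lia.
  have h7 : (6 <= #|U|)%N by clear -U21 U3; lia.
  have := heavy_mod4 (heavy5_sub (subsetDl U Y) hU); rewrite cUY => /(_ h2 h4).
  have := wt_split csym YU; have Y2 := hU Y YU Y5.
  move: lt o6; rewrite /tau oU h6 => lt o6; rewrite o6 !natrB //= subr0 => e1 e2.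
  set m : R := #|U|%:R in U21R dY lt e2 *.
  have m7 : 0 < m - 7 by lra.
  have e3 : 5 * (m - 5) * (m - 7) - 10 <= 30 * wt (U :\: Y).
    rewrite -(ler_pM2l m7); move: e2; nra.
  have e4 : 0 <= (m - 6) * (34 / 15 - wt Y) by apply: mulr_ge0; lra.
  move: lt; rewrite ltNge => /negP; apply; rewrite e1 /= subr0; nra.
move: (lt); rewrite ltNge => /negP; apply.
apply: (matching_step mZ) => // [z zZ|a b aU bU ab].
  have zY : wt Y <= wt (Z :\ z).
    apply: minY; first exact: subset_trans (subsetDl _ _) ZU.
    by rewrite cardsD1_pred // Z6.
  by have := wtD1 csym cxx zZ; lra.
by apply: exact_removing2 => //; clear -U21 U3; lia.
Qed.

(** Averaging loses nothing here: for even m, [tau] is m (m - 2) at m and (m - 2)^2 at m - 1. *)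
Lemma heavy_exact_mod4 U : heavy5 U -> (22 <= #|U|)%N -> (#|U| %% 6 = 4)%N ->
  tau R #|U| <= 6 * wt U.
Proof.
move=> hU U22 U4.
have := @average_step U (tau R #|U|.-1).
have h x : x \in U -> tau R #|U|.-1 <= 6 * wt (U :\ x).
  move=> xU; rewrite -(cardsD1_pred xU); apply: heavy_exact_mod3.
  - exact: heavy5_sub (subsetDl _ _) hU.
  - by rewrite cardsD1_pred //; lia.
  - by rewrite cardsD1_pred //; lia.
have o1 : odd #|U|.-1 by lia.
have o2 : odd #|U| = false by lia.
have U22R : 22%:R <= #|U|%:R :> R by rewrite ler_nat.
move=> /(_ h); rewrite /tau o1 o2 -subn1 natrB ?(leq_trans _ U22) //= subr0 => h2.
have : (#|U|%:R - 2) * ((#|U|%:R) * (#|U|%:R - 2)) <= (#|U|%:R - 2) * (6 * wt U) by lra.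
by rewrite ler_pM2l; [nra | lra].
Qed.

(** In a counterexample the exact bound for [U :\ z] (residue 4) limits [deg z U]; that for
    [U :\: (Z :\ z)] (residue 0) then forces [deg z Z < 1]. Removing pairs leads to residue 3. *)
Lemma heavy_exact_mod5 U : heavy5 U -> (23 <= #|U|)%N -> (#|U| %% 6 = 5)%N ->
  tau R #|U| <= 6 * wt U.
Proof.
move=> hU U23 U5; rewrite leNgt; apply/negP => lt.
have [Z mZ] := ex_min_subset c (leq_trans (isT : 6 <= 23)%N U23); have [ZU Z6 _] := mZ.
have U23R : 23%:R <= #|U|%:R :> R by rewrite ler_nat.
have oU : odd #|U| by clear -U23 U5; lia.
have h2 : (2 <= #|U|)%N by clear -U23 U5; lia.
have h5 : (5 <= #|U|)%N by clear -U23 U5; lia.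
have h1 : (1 <= #|U|)%N by clear -U23 U5; lia.
move: (lt); rewrite ltNge => /negP; apply.
apply: (matching_step mZ) => // [z zZ|a b aU bU ab]; last first.
  rewrite -(cardsD2 aU bU ab); apply: heavy_exact_mod3.
  - exact: heavy5_sub (subset_trans (subsetDl _ _) (subsetDl _ _)) hU.
  - by rewrite cardsD2 //; clear -U23 U5; lia.
  - by rewrite cardsD2 //; clear -U23 U5; lia.
have zU := subsetP ZU z zZ.
have up : 12 * deg z U < 2 * (#|U|%:R - 1).
  have c1 := cardsD1_pred zU.
  have := @heavy_exact_mod4 (U :\ z) (heavy5_sub (subsetDl _ _) hU).
  have o1 : odd #|U|.-1 = false by clear -U23 U5; lia.
  rewrite c1 => /(_ ltac:(clear -U23 U5; lia) ltac:(clear -U23 U5; lia)); move: lt.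
  by rewrite (wtD1 csym cxx zU) /tau oU o1 -subn1 natrB //=; nra.
have YU : Z :\ z \subset U := subset_trans (subsetDl _ _) ZU.
have cY : #|U :\: (Z :\ z)| = (#|U| - 5)%N by rewrite cardsDS // cardsD1_pred // Z6.
have o5 : odd (#|U| - 5) = false by clear -U23 U5; lia.
have := @heavy_exact_mod012 _ (heavy5_sub (subsetDl U (Z :\ z)) hU).
rewrite cY => /(_ ltac:(clear -U23 U5; lia)); rewrite /tau o5 natrB //=.
have := wt_split csym YU; have := deg_outside YU; have := deg_outside ZU.
rewrite (big_setD1 z zZ) /=.
have := wtD1 csym cxx zZ.
have := sum_deg_ge ZU (fun v => heavy_deg mZ (v := v)).
have := heavy6 hU ZU Z6.
move: lt up; rewrite /tau oU Z6 /=; nra.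
Qed.

(** From 20 on, the residues 3, 4 and 5 first occur at 21, 22 and 23. *)
Lemma heavy_exact U : heavy5 U -> (20 <= #|U|)%N -> tau R #|U| <= 6 * wt U.
Proof.
move=> hU U20; have : (#|U| %% 6 < 6)%N by rewrite ltn_mod.
have [lt3|] := ltnP (#|U| %% 6) 3.
  by move=> _; exact: (heavy_exact_mod012).
rewrite leq_eqVlt => /orP[/eqP E|].
  by move=> _; apply: heavy_exact_mod3 => //; lia.
rewrite leq_eqVlt => /orP[/eqP E|].
  by move=> _; apply: heavy_exact_mod4 => //; lia.
move=> h1 h2; apply: heavy_exact_mod5 => //; lia.
Qed.

(** * Covers of equality *)

(** The bound 26 leaves the 20 vertices of [heavy_exact] after the removal of up to six. *)
Definition extremal U := [/\ heavy5 U, (26 <= #|U|)%N & 6 * wt U = tau R #|U|].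
Definition tight U Z := [/\ Z \subset U, #|Z| = 6 & wt Z = 4].
Definition split_by U A := forall x y, x \in U -> y \in U -> x != y ->
  c x y = if (x \in A) == (y \in A) then 1 / 3 else 0.
Definition split3 Z := exists P, [/\ P \subset Z, #|P| = 3 & split_by Z P].

Lemma tight_min U Z : heavy5 U -> tight U Z -> min_subset 6 U Z.
Proof.
move=> hU [ZU Z6 Z4]; split=> // Q QU Q6; rewrite Z4.
exact: (heavy6 hU QU Q6).
Qed.

(** The exact bound for [U :\: Q] is set against equality for [U], which limits the degrees of the
    removed vertices. *)
Lemma extremal_removal U Q : extremal U -> Q \subset U -> (#|Q| <= 6)%N ->
  tau R (#|U| - #|Q|) + 12 * \sum_(a in Q) deg a U - 6 * wt Q <= tau R #|U|.
Proof.
move=> [hU U26 <-] QU Q6.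
have cUQ : #|U :\: Q| = (#|U| - #|Q|)%N by rewrite cardsDS.
have := heavy_exact (heavy5_sub (subsetDl U Q) hU).
rewrite cUQ => /(_ ltac:(clear -U26 Q6; lia)).
rewrite (deg_outside QU) [wt U](wt_split csym QU); lra.
Qed.

(** By [heavy_deg] each of the m - 6 outside degrees is at least 1, and by [extremal_removal] their
    sum is at most m - 6. *)
Lemma tight_deg U Z v : extremal U -> tight U Z -> v \in U :\: Z -> deg v Z = 1.
Proof.
move=> extU tZ vUZ; have [hU U26 eU] := extU; have [ZU Z6 Z4] := tZ.
have mZ := tight_min hU tZ.
have h1 w : w \in U :\: Z -> 1 <= deg w Z := heavy_deg mZ.
have := extremal_removal extU ZU; rewrite Z6 => /(_ isT); rewrite deg_outside // Z4.
set X := \sum_(w in U :\: Z) deg w Z => e1.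
have X1 : X <= #|U|%:R - 6.
  have h6 : (6 <= #|U|)%N by apply: leq_trans U26.
  move: e1; rewrite /tau oddB // addbF natrB //; lra.
have X0 : \sum_(w in U :\: Z) (deg w Z - 1) = 0.
  apply/eqP; rewrite eq_le sumr_ge0 ?andbT => [|w /h1]; last by rewrite subr_ge0.
  rewrite sumrB sumr_const cardsDS // Z6 -/X subr_le0.
  by rewrite natrB // (leq_trans _ U26).
have ge0 w : w \in U :\: Z -> 0 <= deg w Z - 1 by move/h1; rewrite subr_ge0.
by apply/eqP; rewrite -subr_eq0 (psumr_eq0P ge0 X0).
Qed.

Lemma ex_tight U : extremal U -> exists Z, tight U Z.
Proof.
move=> [hU U26 eU]; have [Z mZ] := ex_min_subset c (leq_trans (isT : 6 <= 26)%N U26).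
have [ZU Z6 _] := mZ; exists Z; split=> //; apply/eqP; rewrite eq_le.
rewrite (heavy6 hU ZU Z6) andbT.
have cUZ : #|U :\: Z| = (#|U| - 6)%N by rewrite cardsDS // Z6.
have := heavy_exact (heavy5_sub (subsetDl U Z) hU).
rewrite cUZ => /(_ ltac:(clear -U26; lia)).
have := heavy_step mZ.
have h6 : (6 <= #|U|)%N by apply: leq_trans U26.
by move: eU; rewrite /tau oddB // addbF natrB //; nra.
Qed.

Lemma set3_facts a b d (F : V -> R) : uniq [:: a; b; d] ->
  let Q := a |: (b |: [set d]) in [/\ #|Q| = 3, wt Q = 2 * (c a b + c a d + c b d) &
    \sum_(x in Q) F x = F a + F b + F d].
Proof.
rewrite /= !inE !negb_or andbT => /andP[/andP[ab ad] bd].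
have i1 : b \notin [set d] by rewrite inE.
have i2 : a \notin b |: [set d] by rewrite !inE negb_or ab.
rewrite !cardsU1 cards1 i1 i2; split=> //; last by rewrite !big_setU1 // big_set1 /= addrA.
rewrite !(wtU1 csym cxx) // !degU1 // /wsum /wdeg !big_set1 cxx; ring.
Qed.

Lemma set4_facts a b d e (F : V -> R) : uniq [:: a; b; d; e] ->
  let Q := a |: (b |: (d |: [set e])) in [/\ #|Q| = 4,
    wt Q = 2 * (c a b + c a d + c a e + c b d + c b e + c d e) &
    \sum_(x in Q) F x = F a + F b + F d + F e].
Proof.
rewrite [uniq _]/= !inE !negb_or => /andP[/and3P[ab ad ae] u3].
have ubde : uniq [:: b; d; e] by rewrite /= !inE negb_or.
have [Q3 w3 s3] := set3_facts F ubde; have /andP[/andP[bd be] /andP[de _]] := u3.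
have i2 : a \notin b |: (d |: [set e]) by rewrite !inE !negb_or ab ad.
move=> Q; rewrite /Q cardsU1 i2 Q3; split=> //; last by rewrite big_setU1 // s3 /= !addrA.
have i3 : b \notin d |: [set e] by rewrite !inE negb_or bd.
have i4 : d \notin [set e] by rewrite inE.
rewrite (wtU1 csym cxx) // w3 !degU1 //.
by rewrite /wdeg !big_set1; ring.
Qed.

Lemma split3_seq Z a b d e f g : uniq [:: a; b; d; e; f; g] ->
  Z =i [:: a; b; d; e; f; g] ->
  [/\ c a b = 1 / 3, c a d = 1 / 3 & c b d = 1 / 3] ->
  [/\ c e f = 1 / 3, c e g = 1 / 3 & c f g = 1 / 3] ->
  [/\ c a e = 0, c a f = 0 & c a g = 0] ->
  [/\ c b e = 0, c b f = 0 & c b g = 0] ->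
  [/\ c d e = 0, c d f = 0 & c d g = 0] -> split3 Z.
Proof.
move=> us EZ [h1 h2 h3] [h4 h5 h6] [h7 h8 h9] [h10 h11 h12] [h13 h14 h15].
exists (a |: (b |: [set d])).
have u3 : uniq [:: a; b; d] by move: us; apply: (subseq_uniq (s1 := [:: a; b; d])) => /=; rewrite !eqxx.
have [Q3 _ _] := set3_facts (fun=> 0) u3; split=> //.
  by apply/subsetP => x; rewrite EZ !inE => /or3P[]->; rewrite ?orbT.
move: us; rewrite /= !inE !negb_or.
move=> /and5P[/and5P[ab ad ae af ag] /and4P[bd be bf bg] /and3P[de df dg] _ _].
have aP : a \in a |: (b |: [set d]) by rewrite !inE eqxx.
have bP : b \in a |: (b |: [set d]) by rewrite !inE eqxx orbT.
have dP : d \in a |: (b |: [set d]) by rewrite !inE eqxx !orbT.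
have eP : (e \in a |: (b |: [set d])) = false.
  by rewrite !inE !(eq_sym e) (negPf ae) (negPf be) (negPf de).
have fP : (f \in a |: (b |: [set d])) = false.
  by rewrite !inE !(eq_sym f) (negPf af) (negPf bf) (negPf df).
have gP : (g \in a |: (b |: [set d])) = false.
  by rewrite !inE !(eq_sym g) (negPf ag) (negPf bg) (negPf dg).
move: {Q3} aP bP dP eP fP gP; move: (a |: (b |: [set d])) => P aP bP dP eP fP gP.
move=> x y; rewrite !EZ !inE.
case/or4P => [/eqP->|/eqP->|/eqP->|/or3P[]/eqP->];
case/or4P => [/eqP->|/eqP->|/eqP->|/or3P[]/eqP->];
  rewrite ?eqxx //= => _; rewrite ?aP ?bP ?dP ?eP ?fP ?gP //= csym //.
Qed.

Lemma uniq6_cross a b d e f g x y : uniq [:: a; b; d; e; f; g] ->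
  x \in [:: a; b; d] -> y \in [:: e; f; g] -> x != y.
Proof.
rewrite -[[:: a; b; d; e; f; g]]/([:: a; b; d] ++ [:: e; f; g]) cat_uniq.
move=> /and3P[_ /hasPn h _] xs /h; apply: contra => /eqP <-; exact: xs.
Qed.

(** Total weight 2 leaves exactly 1 on each triangle and 0 across. By the last hypothesis an edge of
    one and an edge of the other sum to at least 2/3; summed over the nine choices this is an
    equality, so every edge has 1/3. *)
Lemma split3_disjoint Z a b d e f g : uniq [:: a; b; d; e; f; g] ->
  Z =i [:: a; b; d; e; f; g] -> wt Z = 4 -> mono col a b d -> mono col e f g ->
  (forall x x' y y', x \in [:: a; b; d] -> x' \in [:: a; b; d] -> x != x' ->
     y \in [:: e; f; g] -> y' \in [:: e; f; g] -> y != y' -> c x y = 0 -> c x y' = 0 ->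
     c x' y = 0 -> c x' y' = 0 -> 2 / 3 <= c x x' + c y y') -> split3 Z.
Proof.
move=> us EZ Z4 /ccov w1 /ccov w2 H.
have w := wt_seq6 us EZ; rewrite Z4 in w.
have := (c0 a e, c0 a f, c0 a g, c0 b e, c0 b f, c0 b g, c0 d e, c0 d f, c0 d g).
move=> [[[[[[[[p1 p2] p3] p4] p5] p6] p7] p8] p9].
have cr : [/\ [/\ c a e = 0, c a f = 0 & c a g = 0],
  [/\ c b e = 0, c b f = 0 & c b g = 0] & [/\ c d e = 0, c d f = 0 & c d g = 0]].
  by split; split; lra.
have [[z1 z2 z3] [z4 z5 z6] [z7 z8 z9]] := cr.
have z x y : x \in [:: a; b; d] -> y \in [:: e; f; g] -> c x y = 0.
  by rewrite !inE => /or3P[]/eqP-> /or3P[]/eqP->.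
have [ab ad bd] : [/\ a != b, a != d & b != d].
  by have := mask_uniq us [:: true; true; true]; rewrite /= !inE negb_or => /andP[/andP[-> ->] /andP[-> _]].
have [ef eg fg] : [/\ e != f, e != g & f != g].
  have := mask_uniq us [:: false; false; false; true; true; true].
  by rewrite /= !inE negb_or => /andP[/andP[-> ->] /andP[-> _]].
have H' x x' y y' : x \in [:: a; b; d] -> x' \in [:: a; b; d] -> x != x' ->
     y \in [:: e; f; g] -> y' \in [:: e; f; g] -> y != y' -> 2 / 3 <= c x x' + c y y'.
  by move=> hx hx' xx' hy hy' yy'; apply: H => //; apply: z.
have [[ia ib id] [ie jf ig]] : [/\ a \in [:: a; b; d], b \in [:: a; b; d] & d \in [:: a; b; d]] /\
  [/\ e \in [:: e; f; g], f \in [:: e; f; g] & g \in [:: e; f; g]].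
  by split; split; rewrite !inE eqxx ?orbT.
have q1 := H' _ _ _ _ ia ib ab ie jf ef; have q2 := H' _ _ _ _ ia ib ab ie ig eg.
have q3 := H' _ _ _ _ ia ib ab jf ig fg; have q4 := H' _ _ _ _ ia id ad ie jf ef.
have q5 := H' _ _ _ _ ia id ad ie ig eg; have q6 := H' _ _ _ _ ia id ad jf ig fg.
have q7 := H' _ _ _ _ ib id bd ie jf ef; have q8 := H' _ _ _ _ ib id bd ie ig eg.
have q9 := H' _ _ _ _ ib id bd jf ig fg.
by apply: (split3_seq us EZ) => //; split; lra.
Qed.

(** * Degrees in an extremal set and the shape of its tight 6-sets *)

Section OneExtremal.
Variable U : {set V}.
Hypothesis extU : extremal U.
Let m : R := #|U|%:R.

Let U26 : (26 <= #|U|)%N. Proof. by case: extU. Qed.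

Let tau_sub k : (k <= 6)%N -> tau R (#|U| - k) = (m - k%:R - 1) ^+ 2 - (odd #|U| == odd k)%:R.
Proof.
move=> k6; have kU : (k <= #|U|)%N by apply: leq_trans k6 (leq_trans _ U26).
by rewrite /tau oddB // natrB //; case: (odd k); case: (odd #|U|).
Qed.

Let tauE : tau R #|U| = (m - 1) ^+ 2 - (~~ odd #|U|)%:R. Proof. by []. Qed.

(** Removing one vertex bounds every degree by (m - 2) / 6, which is also the average. *)
Lemma even_deg x : ~~ odd #|U| -> x \in U -> deg x U = (m - 2) / 6.
Proof.
move=> eU xU.
have le y : y \in U -> 0 <= (m - 2) / 6 - deg y U.
  move=> yU; have yU' : [set y] \subset U by rewrite sub1set.
  have := extremal_removal extU yU'; rewrite cards1 big_set1 => /(_ isT).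
  rewrite tau_sub // tauE (negPf eU) /= {1}/wsum /wdeg !big_set1 cxx.
  rewrite -/(deg y U); lra.
have s0 : \sum_(y in U) ((m - 2) / 6 - deg y U) = 0.
  rewrite sumrB sumr_const -/(wt U) -[(m - 2) / 6 *+ _]mulr_natl -/m.
  have [_ _] := extU; rewrite tauE eU /= => ?; lra.
by apply/esym/eqP; rewrite -subr_eq0 (psumr_eq0P le s0).
Qed.

(** This bound lies above the average degree; [extremal_structure] treats a vertex attaining it
    separately. *)
Lemma odd_deg x : odd #|U| -> x \in U -> deg x U <= (m - 1) / 6.
Proof.
move=> oU xU; have xU' : [set x] \subset U by rewrite sub1set.
have := extremal_removal extU xU'; rewrite cards1 big_set1 => /(_ isT).
rewrite tau_sub // tauE oU /= {1}/wsum /wdeg !big_set1 cxx.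
rewrite -/(deg x U); lra.
Qed.

Lemma inU3 a b d : a \in U -> b \in U -> d \in U -> a |: (b |: [set d]) \subset U.
Proof. by move=> aU bU dU; rewrite !subUset !sub1set aU bU dU. Qed.

Lemma inU4 a b d e : a \in U -> b \in U -> d \in U -> e \in U ->
  a |: (b |: (d |: [set e])) \subset U.
Proof. by move=> aU bU dU eU; rewrite !subUset !sub1set aU bU dU eU. Qed.

Lemma removal3 a b d : uniq [:: a; b; d] -> a \in U -> b \in U -> d \in U ->
  (m - 4) ^+ 2 - (odd #|U|)%:R + 12 * (deg a U + deg b U + deg d U)
    - 12 * (c a b + c a d + c b d) <= (m - 1) ^+ 2 - (~~ odd #|U|)%:R.
Proof.
move=> u3 aU bU dU; have [Q3 w s] := set3_facts (fun x => deg x U) u3.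
have := extremal_removal extU (inU3 aU bU dU); rewrite Q3 w s => /(_ isT).
by rewrite tau_sub // tauE; case: (odd _) => /=; lra.
Qed.

Lemma removal4 a b d e : uniq [:: a; b; d; e] ->
  a \in U -> b \in U -> d \in U -> e \in U ->
  (m - 5) ^+ 2 - (~~ odd #|U|)%:R + 12 * (deg a U + deg b U + deg d U + deg e U)
    - 12 * (c a b + c a d + c a e + c b d + c b e + c d e) <= (m - 1) ^+ 2 - (~~ odd #|U|)%:R.
Proof.
move=> u4 aU bU dU eU; have [Q4 w s] := set4_facts (fun x => deg x U) u4.
have := extremal_removal extU (inU4 aU bU dU eU); rewrite Q4 w s => /(_ isT).
by rewrite tau_sub // tauE; case: (odd _) => /=; lra.
Qed.

Lemma removal2 a b : a != b -> a \in U -> b \in U ->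
  (m - 3) ^+ 2 - (~~ odd #|U|)%:R + 12 * (deg a U + deg b U)
    - 12 * c a b <= (m - 1) ^+ 2 - (~~ odd #|U|)%:R.
Proof.
move=> ab aU bU; have i1 : a \notin [set b] by rewrite inE.
have abU : a |: [set b] \subset U by rewrite !subUset !sub1set aU bU.
have := extremal_removal extU abU; rewrite cardsU1 i1 cards1 (wtU1 csym cxx) //.
rewrite big_setU1 // big_set1 /= {1}/wsum {1 3}/wdeg !big_set1 /wdeg !big_set1 cxx.
move=> /(_ isT).
by rewrite tau_sub // tauE; case: (odd _) => /=; rewrite -/(deg a U) -/(deg b U); lra.
Qed.

Lemma removal_tightD1 Z z : tight U Z -> z \in Z ->
  (m - 6) ^+ 2 - (odd #|U|)%:R + 12 * \sum_(x in Z :\ z) deg x U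
    - 24 + 12 * deg z Z <= (m - 1) ^+ 2 - (~~ odd #|U|)%:R.
Proof.
move=> [ZU Z6 Z4] zZ; have ZzU := subset_trans (subsetDl Z [set z]) ZU.
have := extremal_removal extU ZzU; have := wtD1 csym cxx zZ.
rewrite cardsD1_pred // Z6 Z4 => w /(_ isT).
by rewrite tau_sub // tauE; case: (odd _) => /=; lra.
Qed.


Lemma tight_sum_deg Z : tight U Z -> \sum_(x in Z) deg x U = m - 2.
Proof.
move=> tZ; have [ZU Z6 Z4] := tZ; rewrite (deg_outside ZU) Z4.
rewrite (eq_bigr (fun=> 1)) => [|v vUZ]; last exact: tight_deg extU tZ vUZ.
rewrite sumr_const cardsDS // Z6 natrB ?(leq_trans _ U26) // -/m; ring.
Qed.

(** All degrees are known, so the removal inequalities concern only weights inside [Z]: removing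
    five vertices excludes a book, removing four gives the 2/3 for [split3_disjoint]. *)
Lemma split3_even Z : ~~ odd #|U| -> tight U Z -> split3 Z.
Proof.
move=> eU tZ; have [ZU Z6 Z4] := tZ; have oU := negPf eU.
have dU x : x \in Z -> deg x U = (m - 2) / 6.
  by move=> xZ; apply: even_deg => //; exact: (subsetP ZU).
have d23 z : z \in Z -> deg z Z <= 2 / 3.
  move=> zZ; have := removal_tightD1 tZ zZ; rewrite oU /=.
  have -> : \sum_(x in Z :\ z) deg x U = 5 * ((m - 2) / 6).
    have := tight_sum_deg tZ; rewrite (big_setD1 z zZ) /= dU //; lra.
  lra.
have nb : ~ book Z by move=> [p [q [/d23 ? /d23 ? _]]]; lra.
have [a [b [d [e [f [g [us EZ m1 m2]]]]]]] := two_triangles Z6 nb.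
have inZ x : x \in [:: a; b; d; e; f; g] -> x \in Z by rewrite EZ.
have [[aZ bZ dZ] [eZ fZ gZ]] : [/\ a \in Z, b \in Z & d \in Z] /\ [/\ e \in Z, f \in Z & g \in Z].
  by split; split; apply: inZ; rewrite !inE eqxx ?orbT.
have ZU' := subsetP ZU.
case: m2 => m2.
  apply: (split3_disjoint us EZ Z4 m1 m2) => x x' y y' hx hx' xx' hy hy' yy' z1 z2 z3 z4.
  have [xZ x'Z] : x \in Z /\ x' \in Z.
    by move: hx hx'; rewrite !inE => /or3P[]/eqP-> /or3P[]/eqP->.
  have [yZ y'Z] : y \in Z /\ y' \in Z.
    by move: hy hy'; rewrite !inE => /or3P[]/eqP-> /or3P[]/eqP->.
  have u4 : uniq [:: x; x'; y; y'].
    by rewrite /= !inE !negb_or xx' yy' !(uniq6_cross us).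
  have := removal4 u4 (ZU' _ xZ) (ZU' _ x'Z) (ZU' _ yZ) (ZU' _ y'Z).
  rewrite oU !dU // z1 z2 z3 z4 /=; lra.
have w := wt_seq6 us EZ; rewrite Z4 in w; have w1 := ccov m1; have w2 := ccov m2.
(* Two triangles sharing [a] take all the weight, so [b], [e], [g] span weight 0, while their
   removal requires at least 1/3. *)
have ubeg : uniq [:: b; e; g] := mask_uniq us [:: false; true; false; true; false; true].
have := removal3 ubeg (ZU' _ bZ) (ZU' _ eZ) (ZU' _ gZ); rewrite oU !dU //=.
have := (c0 a g, c0 b e, c0 b f, c0 b g, c0 d e, c0 d f, c0 d g, c0 e g, c0 f g).
move=> [[[[[[[[p1 p2] p3] p4] p5] p6] p7] p8] p9]; lra.
Qed.

(** Two vertices of [Z] joined by weight 0 have degree sum at most (m - 2) / 3, and all six degrees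
    sum to m - 2; so every perfect matching of such pairs attains equality. *)
Lemma split3_odd Z : odd #|U| -> (forall x, x \in U -> deg x U < (m - 1) / 6) ->
  tight U Z -> split3 Z.
Proof.
move=> oU dlt tZ; have [ZU Z6 Z4] := tZ.
have ZU' := subsetP ZU.
have sZ := tight_sum_deg tZ.
have d1 z : z \in Z -> deg z Z < 1.
  move=> zZ; have := removal_tightD1 tZ zZ; rewrite oU /=.
  move: sZ; rewrite (big_setD1 z zZ) /= => e1; have := dlt z (ZU' _ zZ); lra.
have nb : ~ book Z by move=> [p [q [/d1 ? /d1 ? _]]]; lra.
have [a [b [d [e [f [g [us EZ m1 m2]]]]]]] := two_triangles Z6 nb.
have inZ x : x \in [:: a; b; d; e; f; g] -> x \in Z by rewrite EZ.
have [[aZ bZ dZ] [eZ fZ gZ]] : [/\ a \in Z, b \in Z & d \in Z] /\ [/\ e \in Z, f \in Z & g \in Z].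
  by split; split; apply: inZ; rewrite !inE eqxx ?orbT.
have {}sZ : deg a U + deg b U + deg d U + (deg e U + deg f U + deg g U) = m - 2.
  rewrite -sZ; transitivity (\sum_(x <- [:: a; b; d; e; f; g]) deg x U).
    by rewrite !big_cons big_nil; ring.
  by rewrite [LHS]big_uniq; [apply: eq_bigl => x; rewrite EZ | exact: us].
have w := wt_seq6 us EZ; rewrite Z4 in w; have w1 := ccov m1.
have r2 x y : x \in Z -> y \in Z -> x != y -> c x y = 0 -> deg x U + deg y U <= (m - 2) / 3.
  move=> xZ yZ xy cxy; have := removal2 xy (ZU' _ xZ) (ZU' _ yZ); rewrite cxy oU /=; lra.
case: m2 => m2; have w2 := ccov m2.
  apply: (split3_disjoint us EZ Z4 m1 m2) => x x' y y' hx hx' xx' hy hy' yy' z1 z2 z3 z4.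
  have xz u v : u \in [:: a; b; d] -> v \in [:: e; f; g] -> c u v = 0.
    have := (c0 a e, c0 a f, c0 a g, c0 b e, c0 b f, c0 b g, c0 d e, c0 d f, c0 d g).
    move=> [[[[[[[[p1 p2] p3] p4] p5] p6] p7] p8] p9].
    clear -w w1 w2 p1 p2 p3 p4 p5 p6 p7 p8 p9.
    by rewrite !inE => /or3P[]/eqP-> /or3P[]/eqP->; lra.
  have le u v : u \in [:: a; b; d] -> v \in [:: e; f; g] -> deg u U + deg v U <= (m - 2) / 3.
    move=> hu hv; apply: r2; last exact: xz.
    - by move: hu; rewrite !inE => /or3P[]/eqP->.
    - by move: hv; rewrite !inE => /or3P[]/eqP->.
    - exact: uniq6_cross us hu hv.
  have [[ia ib id] [ie jf ig]] : [/\ a \in [:: a; b; d], b \in [:: a; b; d] & d \in [:: a; b; d]] /\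
    [/\ e \in [:: e; f; g], f \in [:: e; f; g] & g \in [:: e; f; g]].
    by split; split; rewrite !inE eqxx ?orbT.
  have l1 := le _ _ ia ie; have l2 := le _ _ ia jf; have l3 := le _ _ ia ig.
  have l4 := le _ _ ib ie; have l5 := le _ _ ib jf; have l6 := le _ _ ib ig.
  have l7 := le _ _ id ie; have l8 := le _ _ id jf; have l9 := le _ _ id ig.
  have ge u v : u \in [:: a; b; d] -> v \in [:: e; f; g] -> (m - 2) / 3 <= deg u U + deg v U.
    by clear -sZ l1 l2 l3 l4 l5 l6 l7 l8 l9; rewrite !inE => /or3P[]/eqP-> /or3P[]/eqP->; lra.
  have [xZ x'Z] : x \in Z /\ x' \in Z.
    by move: hx hx'; rewrite !inE => /or3P[]/eqP-> /or3P[]/eqP->.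
  have [yZ y'Z] : y \in Z /\ y' \in Z.
    by move: hy hy'; rewrite !inE => /or3P[]/eqP-> /or3P[]/eqP->.
  have u4 : uniq [:: x; x'; y; y'].
    by rewrite /= !inE !negb_or xx' yy' !(uniq6_cross us).
  have := removal4 u4 (ZU' _ xZ) (ZU' _ x'Z) (ZU' _ yZ) (ZU' _ y'Z).
  have := ge _ _ hx hy; have := ge _ _ hx' hy'.
  rewrite oU z1 z2 z3 z4 /=; lra.
(* The pairs [a g], [b e], [d f] form such a matching. As [a] has degree below (m - 1) / 6, [g] has
   degree above (m - 3) / 6, too much for the removal of [b], [e], [g]. *)
have ubeg : uniq [:: b; e; g] := mask_uniq us [:: false; true; false; true; false; true].
have ne (i j : V) : uniq [:: i; j] -> i != j by rewrite /= inE andbT.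
have ag := ne a g (mask_uniq us [:: true; false; false; false; false; true]).
have be := ne b e (mask_uniq us [:: false; true; false; true; false; false]).
have df := ne d f (mask_uniq us [:: false; false; true; false; true; false]).
have := removal3 ubeg (ZU' _ bZ) (ZU' _ eZ) (ZU' _ gZ); rewrite oU /=.
have := (c0 a g, c0 b e, c0 b f, c0 b g, c0 d e, c0 d f, c0 d g, c0 e g, c0 f g).
move=> [[[[[[[[p1 p2] p3] p4] p5] p6] p7] p8] p9].
have := r2 _ _ aZ gZ ag ltac:(lra); have := r2 _ _ bZ eZ be ltac:(lra).
have := r2 _ _ dZ fZ df ltac:(lra); have := dlt a (ZU' _ aZ).
have := dlt b (ZU' _ bZ); lra.
Qed.

End OneExtremal.

(** * Spreading the split to the whole set by exchanges *)

Lemma split_byC U A : split_by U A -> split_by U (U :\: A).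
Proof.
move=> h x y xU yU xy; rewrite h // !inE xU yU !andbT.
by case: (x \in A); case: (y \in A).
Qed.

Lemma split_by_sub U A Z P : split_by U A -> Z \subset U -> A :&: Z = P -> split_by Z P.
Proof.
move=> h ZU <- x y xZ yZ xy; rewrite h ?(subsetP ZU) // !inE xZ yZ !andbT //.
Qed.

Lemma split_by_deg U A x : A \subset U -> split_by U A -> x \in A ->
  deg x U = (#|A|%:R - 1) / 3.
Proof.
move=> AU h xA; have xU := subsetP AU x xA.
rewrite -(deg_self cxx) /wdeg.
rewrite (eq_bigr (fun y => if y \in A then 1 / 3 else 0)) => [|y]; last first.
  by rewrite !inE => /andP[yx yU]; rewrite h // ?xA 1?eq_sym //; case: (y \in A).
rewrite -big_mkcondr /= (eq_bigl (fun y => y \in A :\ x)) => [|y]; last first.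
  rewrite !inE -andbA; congr (_ && _); apply/andP/idP => [[]//|yA].
  by rewrite (subsetP AU).
rewrite sumr_card cardsD1_pred // -subn1 natrB; first by ring.
by rewrite card_gt0; apply/set0Pn; exists x.
Qed.

Lemma split3_deg Z P p : P \subset Z -> #|Z| = 6 -> #|P| = 3 -> split_by Z P ->
  p \in Z -> deg p Z = 2 / 3.
Proof.
move=> PZ Z6 P3 h pZ; have [pP|pP] := boolP (p \in P).
  by rewrite (split_by_deg PZ h pP) P3; lra.
have pP' : p \in Z :\: P by rewrite inE pP.
by rewrite (split_by_deg (subsetDl _ _) (split_byC h) pP') cardsDS // Z6 P3 natrB //; lra.
Qed.

Lemma split3_wt Z P : P \subset Z -> #|Z| = 6 -> #|P| = 3 -> split_by Z P -> wt Z = 4.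
Proof.
move=> PZ Z6 P3 h; rewrite /wsum (eq_bigr (fun=> 2 / 3)) => [|p pZ].
  by rewrite sumr_card Z6; lra.
exact: split3_deg h pZ.
Qed.

Lemma split_by_wt U A : A \subset U -> split_by U A ->
  3 * wt U = #|A|%:R * (#|A|%:R - 1) + #|U :\: A|%:R * (#|U :\: A|%:R - 1).
Proof.
move=> AU h; rewrite /wsum (big_setID A) /= (setIidPr AU).
rewrite (eq_bigr (fun=> (#|A|%:R - 1) / 3)) => [|x]; last exact: split_by_deg.
rewrite [X in _ + X](eq_bigr (fun=> (#|U :\: A|%:R - 1) / 3)) => [|x]; last first.
  apply: split_by_deg; [exact: subsetDl | exact: split_byC].
rewrite !sumr_card; lra.
Qed.

(** With class sizes a and b and m = a + b, six times the weight is m^2 - 2m + (a - b)^2. *)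
Lemma split_by_balanced U A : A \subset U -> split_by U A -> 6 * wt U = tau R #|U| ->
  (#|A|%:R - #|U :\: A|%:R) ^+ 2 = (odd #|U|)%:R :> R.
Proof.
move=> AU h eU; have := split_by_wt AU h.
have : #|U|%:R = #|A|%:R + #|U :\: A|%:R :> R.
  by rewrite -natrD -(cardsID A U) (setIidPr AU).
by move: eU; rewrite /tau; case: (odd _) => /=; nra.
Qed.

Lemma swap_tight U Z p v : extremal U -> tight U Z -> p \in Z -> v \in U :\: Z ->
  deg p (v |: Z) = 1 -> tight U ((v |: Z) :\ p).
Proof.
move=> extU tZ pZ vUZ dp; have := tight_deg extU tZ vUZ => dv.
have [ZU Z6 Z4] := tZ; have /setDP[vU vZ] := vUZ.
have pS : p \in v |: Z by rewrite !inE pZ orbT.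
split.
- by apply: subset_trans (subsetDl _ _) _; rewrite subUset sub1set vU.
- by rewrite cardsD1_pred // cardsU1 vZ Z6.
- by have := wtD1 csym cxx pS; rewrite (wtU1 csym cxx vZ) Z4 dv dp; lra.
Qed.

(** By [tight_deg], [w] has degree 1 both to [Z] and to the set with [v] in place of [p]. *)
Lemma swap_eq U Z p v w : extremal U -> tight U Z -> p \in Z -> v \in U :\: Z ->
  deg p (v |: Z) = 1 -> w \in U :\: Z -> w != v -> c w v = c w p.
Proof.
move=> extU tZ pZ vUZ dp wUZ wv.
have tZ' := swap_tight extU tZ pZ vUZ dp.
have /setDP[vU vZ] := vUZ; have /setDP[wU wZ] := wUZ.
have pS : p \in v |: Z by rewrite !inE pZ orbT.
have wUZ' : w \in U :\: ((v |: Z) :\ p) by rewrite !inE (negPf wv) (negPf wZ) wU andbF.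
have := tight_deg extU tZ wUZ.
have := tight_deg extU tZ' wUZ'.
have := degD1 c w pS; rewrite degU1 //; lra.
Qed.

(** [v |: Z] weighs 6, less than the 7 of [good7], so it has a book. Its degrees are at most 1,
    since its 6-subsets weigh at least 4; hence both vertices of the book have degree 1, and one of
    them lies in [Z]. *)
Lemma swappable U Z v : extremal U -> tight U Z -> v \in U :\: Z ->
  exists2 p, p \in Z & deg p (v |: Z) = 1.
Proof.
move=> extU tZ vUZ; have dv := tight_deg extU tZ vUZ.
have [ZU Z6 Z4] := tZ; have /setDP[vU vZ] := vUZ; have [hU _ _] := extU.
have SU : v |: Z \subset U by rewrite subUset sub1set vU.
have S7 : #|v |: Z| = 7 by rewrite cardsU1 vZ Z6.
have wS : wt (v |: Z) = 6 by rewrite (wtU1 csym cxx vZ) Z4 dv; lra.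
have le1 x : x \in v |: Z -> deg x (v |: Z) <= 1.
  move=> xS; have S6 : #|(v |: Z) :\ x| = 6 by rewrite cardsD1_pred // S7.
  have := heavy6 hU (subset_trans (subsetDl _ [set x]) SU) S6.
  have := wtD1 csym cxx xS; lra.
have [[p [q [pS qS pq ge2]]]|] := good7 S7; last by rewrite wS; lra.
have lp := le1 _ pS; have lq := le1 _ qS.
have [pv|pv] := eqVneq p v.
  exists q; last by lra.
  by move: qS; rewrite !inE -pv eq_sym (negPf pq).
exists p; last by lra.
by move: pS; rewrite !inE (negPf pv).
Qed.

(** A vertex of [Z :\: P] in the new class of [v] would bring all of [Z :\: P] along, making four
    vertices in a class of three; so [v] takes the place of [p] beside the rest of [P]. *)
Lemma attach_core Z P p v : v \notin Z -> P \subset Z -> #|Z| = 6 -> #|P| = 3 ->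
  split_by Z P -> p \in P -> c p v = 1 / 3 -> split3 ((v |: Z) :\ p) ->
  forall z, z \in Z -> c v z = if z \in P then 1 / 3 else 0.
Proof.
move=> vZ PZ Z6 P3 hP pP cpv [P0 [P0S P03 hP0]].
have pZ := subsetP PZ p pP.
have vS : v \in (v |: Z) :\ p by rewrite !inE eqxx andbT; apply: contraNneq vZ => ->.
have S6 : #|(v |: Z) :\ p| = 6.
  by rewrite cardsD1_pred ?cardsU1 ?vZ ?Z6 // !inE pZ orbT.
have [P' [P'3 hP' vP']] : exists P', [/\ #|P'| = 3, split_by ((v |: Z) :\ p) P' & v \in P'].
  have [vP0|vP0] := boolP (v \in P0); first by exists P0.
  exists (((v |: Z) :\ p) :\: P0); split; last by rewrite inE vP0.
    by rewrite cardsDS // S6 P03.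
  exact: split_byC.
have inS z : z \in Z -> z != p -> z \in (v |: Z) :\ p.
  by move=> zZ zp; rewrite !inE zp zZ orbT.
have nZP z : z \in Z -> z \notin P -> z != p by move=> _; apply: contraNneq => ->.
have hh : 1 / 3 != 0 :> R by apply/eqP; lra.
have f1 z : z \in Z -> z \notin P -> z \notin P'.
  move=> zZ zP; apply/negP => zP'.
  have : (#|v |: (Z :\: P)| <= #|P'|)%N.
    apply: subset_leq_card; rewrite subUset sub1set vP'; apply/subsetP => w.
    rewrite inE => /andP[wP wZ]; have [->//|zw] := eqVneq w z.
    have := hP _ _ wZ zZ zw; rewrite (negPf wP) (negPf zP) eqxx.
    rewrite hP' ?inS ?nZP // zP'; case: (w \in P') => //= /esym/eqP.
    by rewrite (negPf hh).
  by rewrite cardsU1 !inE (negPf vZ) andbF /= cardsDS // Z6 P3 P'3.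
have [w wZ wP] : exists2 w, w \in Z & w \notin P.
  have : (0 < #|Z :\: P|)%N by rewrite cardsDS // Z6 P3.
  by case/card_gt0P => w /setDP[]; exists w.
move=> z zZ; have vz : v != z by apply: contraNneq vZ => ->.
have [zp|zp] := eqVneq z p; first by rewrite zp pP csym.
rewrite hP' ?(inS z) // vP'; have [zP|zP] := boolP (z \in P); last first.
  by rewrite (negPf (f1 z zZ zP)).
suff -> : z \in P' by [].
have zw : z != w by apply: contraNneq wP => <-.
have := hP _ _ zZ wZ zw; rewrite zP (negPf wP) /= hP' ?(inS z) ?(inS w) ?(nZP w) //.
by rewrite (negPf (f1 w wZ wP)); case: (z \in P') => //= /eqP; rewrite (negPf hh).
Qed.

Lemma attach U Z P v : extremal U -> (forall Z, tight U Z -> split3 Z) ->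
  tight U Z -> P \subset Z -> #|P| = 3 -> split_by Z P -> v \in U :\: Z ->
  (forall z, z \in Z -> c v z = if z \in P then 1 / 3 else 0) \/
  (forall z, z \in Z -> c v z = if z \in P then 0 else 1 / 3).
Proof.
move=> extU sp tZ PZ P3 hP vUZ; have [p pZ dp] := swappable extU tZ vUZ.
have [ZU Z6 Z4] := tZ; have /setDP[vU vZ] := vUZ.
have cpv : c p v = 1 / 3.
  by move: dp; rewrite degU1 // (split3_deg PZ Z6 P3 hP pZ); lra.
have := sp _ (swap_tight extU tZ pZ vUZ dp) => sp'.
have [pP|pP] := boolP (p \in P).
  by left; exact: (attach_core vZ PZ Z6 P3 hP pP cpv sp').
right=> z zZ; have pP' : p \in Z :\: P by rewrite inE pP.
have P3' : #|Z :\: P| = 3 by rewrite cardsDS // Z6 P3.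
rewrite (attach_core vZ (subsetDl _ _) Z6 P3' (split_byC hP) pP' cpv sp' zZ).
by rewrite inE zZ andbT; case: (z \in P).
Qed.

Lemma structure_split U : extremal U -> (forall Z, tight U Z -> split3 Z) ->
  exists2 A : {set V}, A \subset U & split_by U A.
Proof.
move=> extU sp; have [Z tZ] := ex_tight extU.
have [P [PZ P3 hP]] := sp Z tZ; have [ZU Z6 Z4] := tZ.
have [z0 z0P] : exists z, z \in P by apply/card_gt0P; rewrite P3.
have [z1 z1Z z1P] : exists2 w, w \in Z & w \notin P.
  have : (0 < #|Z :\: P|)%N by rewrite cardsDS // Z6 P3.
  by case/card_gt0P => w /setDP[]; exists w.
have hh : (0 == 1 / 3 :> R) = false by apply/negP => /eqP; lra.
(* Outside [Z], the weight to the single vertex [z0] of [P] decides the class, by [attach]. *)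
pose A := [set v in U | if v \in Z then v \in P else c v z0 == 1 / 3].
have AZ z : z \in Z -> (z \in A) = (z \in P).
  by move=> zZ; rewrite inE zZ (subsetP ZU).
have hA v z : v \in U -> z \in Z -> v != z ->
    c v z = if (v \in A) == (z \in A) then 1 / 3 else 0.
  move=> vU zZ vz; rewrite (AZ z zZ); have [vZ|vZ] := boolP (v \in Z).
    by rewrite AZ // hP.
  have vUZ : v \in U :\: Z by rewrite inE vZ.
  rewrite inE vU (negPf vZ) /=; have z0Z := subsetP PZ z0 z0P.
  by case: (attach extU sp tZ PZ P3 hP vUZ) => h; rewrite !h // z0P ?eqxx ?hh;
    case: (z \in P).
exists A; first by apply/subsetP => x; rewrite inE => /andP[].
move=> w v wU vU wv; have [vZ|vZ] := boolP (v \in Z); first exact: hA.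
have [wZ|wZ] := boolP (w \in Z); first by rewrite csym hA // 1?eq_sym // eq_sym.
have vUZ : v \in U :\: Z by rewrite inE vZ.
have wUZ : w \in U :\: Z by rewrite inE wZ.
have [p pZ pA] : exists2 p, p \in Z & (p \in A) = (v \in A).
  case: (boolP (v \in A)) => _; [exists z0 | exists z1] => //; rewrite ?(subsetP PZ) //.
    by rewrite AZ ?(subsetP PZ).
  by rewrite AZ // (negPf z1P).
have pv : p != v by apply: contraNneq vZ => <-.
have wp : w != p by apply: contraNneq wZ => ->.
(* So [v] can replace [p], a vertex of its class whose weight to [w] is known. *)
have dp : deg p (v |: Z) = 1.
  rewrite degU1 // (split3_deg PZ Z6 P3 hP pZ) csym hA // 1?eq_sym // pA eqxx; lra.
by rewrite (swap_eq extU tZ pZ vUZ dp wUZ wv) hA // pA.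
Qed.

Lemma tight_two_classes U U' K P Q : U' \subset U -> K \subset U' -> split_by U' K ->
  P \subset K -> Q \subset U' :\: K -> #|P| = 3 -> #|Q| = 3 ->
  [/\ tight U (P :|: Q), split_by (P :|: Q) P & [disjoint P & Q]].
Proof.
move=> U'U KU' hK PK QK P3 Q3.
have dPQ : [disjoint P & Q].
  apply: disjointWl PK _; apply: disjointWr QK _.
  by rewrite disjoints_subset setDE setCI setCK subsetUr.
have ZU' : P :|: Q \subset U'.
  by rewrite subUset (subset_trans PK KU') (subset_trans QK (subsetDl _ _)).
have Z6 : #|P :|: Q| = 6 by rewrite cardsU (disjoint_setI0 dPQ) cards0 P3 Q3.
have hZ : split_by (P :|: Q) P.
  apply: (split_by_sub hK ZU'); rewrite setIUr (setIidPr PK).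
  have -> : K :&: Q = set0.
    by apply/eqP; rewrite setI_eq0 disjoint_sym disjoints_subset (subset_trans QK) // setDE subsetIr.
  by rewrite setU0.
split=> //; split=> //; first exact: subset_trans ZU' U'U.
exact: split3_wt (subsetUl P Q) Z6 P3 hZ.
Qed.

(** [p], two further vertices of [K] and three of the other class form a tight set in which [v] can
    replace [p]; [swap_eq] then compares the weights to [x]. *)
Lemma class_const U x K : extremal U -> x \in U -> K \subset U :\ x ->
  split_by (U :\ x) K -> (4 <= #|K|)%N -> (3 <= #|(U :\ x) :\: K|)%N ->
  forall p v, p \in K -> v \in K -> c x v = c x p.
Proof.
move=> extU xU KU hK K4 B3 p v pK vK; have [->//|vp] := eqVneq v p.
have vKp : v \in K :\ p by rewrite !inE vp.
have [P0 P0K P02] : exists2 P0 : {set V}, P0 \subset K :\ p :\ v & #|P0| = 2.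
  apply: exists_subset; rewrite !cardsD1_pred //.
  by rewrite -subn2 leq_subRL // (leq_trans _ K4).
have [Q QB Q3] := exists_subset B3.
have pP0 : p \notin P0 by apply/negP => /(subsetP P0K); rewrite !inE eqxx andbF.
have vP0 : v \notin P0 by apply/negP => /(subsetP P0K); rewrite !inE eqxx.
have PK : p |: P0 \subset K.
  rewrite subUset sub1set pK (subset_trans P0K) // (subset_trans (subsetDl _ _)) //.
  exact: subsetDl.
have P3 : #|p |: P0| = 3 by rewrite cardsU1 pP0 P02.
have [tZ hZ dPQ] := tight_two_classes (subsetDl U [set x]) KU hK PK QB P3 Q3.
have [ZU Z6 _] := tZ.
have pZ : p \in (p |: P0) :|: Q by rewrite !inE eqxx.
have notQ y : y \in K -> y \notin Q.
  by move=> yK; apply/negP => /(subsetP QB); rewrite inE yK.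
have vZ : v \notin (p |: P0) :|: Q by rewrite !inE (negPf vp) (negPf vP0) (negPf (notQ v vK)).
have vU' := subsetP KU v vK; have pU' := subsetP KU p pK.
have vU : v \in U by move: vU'; rewrite inE => /andP[].
have vUZ : v \in U :\: ((p |: P0) :|: Q) by rewrite inE vZ.
have vx : v != x by move: vU'; rewrite !inE => /andP[].
have xZ : x \in U :\: ((p |: P0) :|: Q).
  rewrite inE xU andbT; apply/negP => /setUP[/(subsetP PK)/(subsetP KU)|/(subsetP QB)].
    by rewrite !inE eqxx.
  by rewrite !inE eqxx andbF.
apply: (swap_eq extU tZ pZ vUZ _ xZ); last by rewrite eq_sym.
rewrite degU1 // (split3_deg (subsetUl _ _) Z6 P3 hZ pZ) hK // ?pK ?vK 1?eq_sym //=.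
lra.
Qed.

(** Weights at [x] are constant on each class, and [x] has degree 1 to a tight set with three
    vertices in each; 1/3 on [K] leaves 0 on the other class. *)
Lemma extend_core U x K p : extremal U -> x \in U -> K \subset U :\ x ->
  split_by (U :\ x) K -> (4 <= #|K|)%N -> (4 <= #|(U :\ x) :\: K|)%N ->
  p \in K -> c x p = 1 / 3 -> split_by U (x |: K).
Proof.
move=> extU xU KU hK K4 B4 pK cxp; set B := (U :\ x) :\: K in B4 *.
have B3 : (3 <= #|B|)%N by apply: leq_trans B4.
have K3 : (3 <= #|K|)%N by apply: leq_trans K4.
have cK y : y \in K -> c x y = 1 / 3.
  by move=> yK; rewrite (class_const extU xU KU hK K4 B3 pK yK).
have KB : (U :\ x) :\: B = K.
  by rewrite /B setDDr setDv set0U; apply/setIidPr.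
have [q qB] : exists q, q \in B by apply/card_gt0P; apply: leq_trans B4.
have cBq y : y \in B -> c x y = c x q.
  move=> yB; apply: (class_const extU xU (subsetDl _ _) (split_byC hK) B4 _ qB yB).
  by rewrite KB.
have cq : c x q = 0.
  have [P PK P3] := exists_subset K3; have [Q QB Q3] := exists_subset B3.
  have [tZ hZ dPQ] := tight_two_classes (subsetDl U [set x]) KU hK PK QB P3 Q3.
  have xZ : x \in U :\: (P :|: Q).
    rewrite inE xU andbT; apply/negP => /setUP[/(subsetP PK)/(subsetP KU)|/(subsetP QB)].
      by rewrite !inE eqxx.
    by rewrite !inE eqxx andbF.
  have := tight_deg extU tZ xZ; rewrite degU // /wdeg.
  rewrite (eq_bigr (fun=> 1 / 3)) => [|y yP]; last exact/cK/(subsetP PK).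
  rewrite [X in _ + X](eq_bigr (fun=> c x q)) => [|y yQ]; last exact/cBq/(subsetP QB).
  rewrite !sumr_card P3 Q3; lra.
have xK : x \notin K by apply/negP => /(subsetP KU); rewrite !inE eqxx.
have cx y : y \in U -> y != x -> c x y = if y \in K then 1 / 3 else 0.
  move=> yU yx; case: ifPn => [|yK]; first exact: cK.
  by rewrite cBq // !inE yK yx.
move=> y z yU zU yz; rewrite !inE.
have [yx|yx] := eqVneq y x.
  by rewrite -{1}yx in cx; rewrite yx cx // -?yx 1?eq_sym // -?yx; move: yz; rewrite yx eq_sym => /negPf->; case: (z \in K).
have [zx|zx] := eqVneq z x; first by rewrite zx csym cx //=; case: (y \in K).
by rewrite hK ?inE ?yx ?zx.
Qed.

Lemma extremal_structure U : extremal U -> exists2 A : {set V}, A \subset U & split_by U A.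
Proof.
move=> extU; have [oU|eU] := boolP (odd #|U|); last first.
  apply: (structure_split extU) => Z tZ.
  exact: (split3_even extU eU tZ).
have [H|] := pselect (forall x, x \in U -> deg x U < (#|U|%:R - 1) / 6).
  apply: (structure_split extU) => Z tZ.
  exact: (split3_odd extU oU H tZ).
(* There remains a vertex [x] of degree exactly (m - 1) / 6. Its removal leaves an extremal set of
   even size, still at least 26 because m is odd. *)
move=> /existsNP[x /not_implyP[xU /negP]]; rewrite -leNgt => dge.
have dle := odd_deg extU oU xU.
have [hU U26 eU] := extU.
have o' : odd #|U|.-1 = false by clear -oU U26; lia.
have c1 := cardsD1_pred xU.
have extU' : extremal (U :\ x).
  split; first exact: heavy5_sub (subsetDl _ _) hU.
    by rewrite c1; clear -oU U26; lia.
  have := wtD1 csym cxx xU; move: eU; rewrite /tau c1 o' oU /=.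
  rewrite -subn1 natrB; last by apply: leq_trans U26.
  move=> e1 e2; nra.
have [K KU hK] : exists2 A : {set V}, A \subset U :\ x & split_by (U :\ x) A.
  apply: (structure_split extU') => Z tZ.
  by apply: (split3_even extU' _ tZ); rewrite c1 o'.
have [_ _ eU'] := extU'.
have KB : #|K| = #|(U :\ x) :\: K|.
  have := split_by_balanced KU hK eU'; rewrite c1 o' => /eqP.
  by rewrite sqrf_eq0 subr_eq0 eqr_nat => /eqP.
have KBs : (#|K| + #|(U :\ x) :\: K| = #|U|.-1)%N.
  by rewrite -c1 -(cardsID K (U :\ x)) (setIidPr KU).
have K4 : (4 <= #|K|)%N by clear -KB KBs U26; lia.
have B4 : (4 <= #|(U :\ x) :\: K|)%N by clear -KB KBs U26; lia.
have [P PK P3] := exists_subset (leq_trans (isT : 3 <= 4)%N K4).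
have [Q QB Q3] := exists_subset (leq_trans (isT : 3 <= 4)%N B4).
have [tZ hZ dPQ] := tight_two_classes (subsetDl U [set x]) KU hK PK QB P3 Q3.
have [_ Z6 _] := tZ.
have xZ : x \in U :\: (P :|: Q).
  rewrite inE xU andbT; apply/negP => /setUP[/(subsetP PK)/(subsetP KU)|/(subsetP QB)].
    by rewrite !inE eqxx.
  by rewrite !inE eqxx andbF.
(* The vertex that [x] can replace shows which class [x] joins. *)
have [p pZ dp] := swappable extU tZ xZ.
have cxp : c x p = 1 / 3.
  have /setDP[_ xZ'] := xZ; move: dp; rewrite degU1 //.
  by rewrite (split3_deg (subsetUl _ _) Z6 P3 hZ pZ) csym; lra.
have sx (K' : {set V}) : K' \subset U :\ x -> x |: K' \subset U.
  by move=> h; rewrite subUset sub1set xU (subset_trans h (subsetDl _ _)).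
have /setUP[pP|pQ] := pZ.
  exists (x |: K); first exact: sx.
  exact: (extend_core extU xU KU hK K4 B4 (subsetP PK p pP) cxp).
exists (x |: ((U :\ x) :\: K)); first exact/sx/subsetDl.
apply: (extend_core extU xU (subsetDl _ _) (split_byC hK) B4 _ (subsetP QB p pQ) cxp).
by rewrite setDDr setDv set0U (setIidPr KU).
Qed.

(** * Colours forced by the split weighting *)

Lemma mono_one_class U A x y z : split_by U A -> x \in U -> y \in U -> z \in U ->
  mono col x y z -> ((x \in A) == (y \in A)) && ((y \in A) == (z \in A)).
Proof.
move=> h xU yU zU m; have := ccov m; have [/and3P[xy yz xz] _] := andP m.
(* A triangle meeting both classes weighs only 1/3. *)
rewrite !h //; case: (x \in A); case: (y \in A); case: (z \in A) => //=; lra.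
Qed.

Lemma mono_of_eq x y z (k : bool) : x != y -> y != z -> x != z ->
  col x y = k -> col y z = k -> col x z = k -> mono col x y z.
Proof. by rewrite /mono /dist3 => -> -> -> -> -> ->; rewrite eqxx. Qed.

(* A vertex outside the class of the triangle [a b d] has at most one edge of
   its colour to it, so two such vertices have a common neighbour of the other
   colour on the triangle. *)
Lemma opposite_class_clique U A a b d : split_by U A ->
  a \in U -> b \in U -> d \in U -> mono col a b d ->
  forall y z, y \in U -> z \in U -> y != z -> (y \in A) != (a \in A) ->
    (z \in A) != (a \in A) -> col y z = col a b.
Proof.
move=> h aU bU dU m y z yU zU yz yA zA.
have /andP[/eqP aAb /eqP bAd] := mono_one_class h aU bU dU m.
have [/and3P[ab bd ad] /andP[/eqP e1 /eqP e2]] := andP m.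
have ne u v : (u \in A) != (v \in A) -> u != v by apply: contraNneq => ->.
have yb : (y \in A) != (b \in A) by rewrite -aAb.
have yd : (y \in A) != (d \in A) by rewrite -bAd -aAb.
have zb : (z \in A) != (b \in A) by rewrite -aAb.
have zd : (z \in A) != (d \in A) by rewrite -bAd -aAb.
have two u v w : u \in U -> v \in U -> w \in U -> u != v -> (w \in A) != (v \in A) ->
    (w \in A) != (u \in A) -> col u v = col a b -> ~~ ((col u w == col a b) && (col v w == col a b)).
  move=> uU vU wU uv wv wu cuv; apply/negP => /andP[/eqP k1 /eqP k2].
  have mm : mono col u v w by apply: (mono_of_eq (k := col a b)) => //; rewrite ne // eq_sym.
  have := mono_one_class h uU vU wU mm; move: wv wu.
  by case: (u \in A); case: (v \in A); case: (w \in A).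
have y1 := two a b y aU bU yU ab yb yA erefl.
have y2 := two b d y bU dU yU bd yd yb (esym e1).
have y3 := two a d y aU dU yU ad yd yA (etrans (esym e2) (esym e1)).
have z1 := two a b z aU bU zU ab zb zA erefl.
have z2 := two b d z bU dU zU bd zd zb (esym e1).
have z3 := two a d z aU dU zU ad zd zA (etrans (esym e2) (esym e1)).
have noo o : o \in U -> (y \in A) != (o \in A) -> (z \in A) != (o \in A) ->
    col o y != col a b -> col o z != col a b -> col y z = col a b.
  move=> oU yo zo ky kz; apply: contrapT => /eqP kyz.
  have mm : mono col o y z.
    apply: (mono_of_eq (k := ~~ col a b)) => //; rewrite 1?ne 1?eq_sym //.
    - by move: ky; case: (col o y); case: (col a b).
    - by move: kyz; case: (col y z); case: (col a b).
    - by move: kz; case: (col o z); case: (col a b).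
  have := mono_one_class h oU yU zU mm; move: yo.
  by case: (o \in A); case: (y \in A).
have [k1|k1] := boolP ((col a y != col a b) && (col a z != col a b)).
  by case/andP: k1; exact: noo.
have [k2|k2] := boolP ((col b y != col a b) && (col b z != col a b)).
  by case/andP: k2; exact: noo.
have [k3|k3] := boolP ((col d y != col a b) && (col d z != col a b)).
  by case/andP: k3; exact: noo.
move: k1 k2 k3 y1 y2 y3 z1 z2 z3.
by case: (col a y == _); case: (col a z == _); case: (col b y == _); case: (col b z == _);
   case: (col d y == _); case: (col d z == _).
Qed.

(** Six vertices of [A] contain a monochromatic triangle, which colours the other class; a triangle
    there colours [A] in turn. Two crossing edges of that colour at one vertex would close a
    monochromatic triangle meeting both classes. *)
Lemma split_colours U A : A \subset U -> split_by U A -> (6 <= #|A|)%N ->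
  (3 <= #|U :\: A|)%N -> exists k : bool,
  (forall y z, y \in U -> z \in U -> y != z -> (y \in A) = (z \in A) -> col y z = k) /\
  (forall x y z, x \in U -> y \in U -> z \in U -> (x \in A) != (y \in A) ->
     (x \in A) != (z \in A) -> col x y = k -> col x z = k -> y = z).
Proof.
move=> AU h A6 B3; have [Z ZA Z6] := exists_subset A6.
have [a [b [d [aZ bZ dZ m]]]] := ex_mono Z6.
have [aA bA dA] := And3 (subsetP ZA a aZ) (subsetP ZA b bZ) (subsetP ZA d dZ).
have [aU bU dU] := And3 (subsetP AU a aA) (subsetP AU b bA) (subsetP AU d dA).
have cB y z : y \in U -> z \in U -> y != z -> y \notin A -> z \notin A -> col y z = col a b.
  move=> yU zU yz yA zA; apply: (opposite_class_clique h aU bU dU m) => //.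
    by rewrite aA (negPf yA).
  by rewrite aA (negPf zA).
have [Y YB Y3] := exists_subset B3; have [e [f [g [u3 EY]]]] := enum3 Y3.
have inB x : x \in [:: e; f; g] -> x \in U /\ x \notin A.
  by rewrite -EY => /(subsetP YB)/setDP.
have [eU eA] := inB e ltac:(by rewrite !inE eqxx).
have [fU fA] := inB f ltac:(by rewrite !inE eqxx orbT).
have [gU gA] := inB g ltac:(by rewrite !inE eqxx !orbT).
have /andP[/andP[ef eg] fg] : (e != f) && (e != g) && (f != g).
  by move: u3; rewrite /= !inE negb_or andbT.
have m' : mono col e f g by apply: (mono_of_eq (k := col a b)) => //; exact: cB.
have cA y z : y \in U -> z \in U -> y != z -> y \in A -> z \in A -> col y z = col a b.
  move=> yU zU yz yA zA; rewrite -(cB e f eU fU ef eA fA).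
  apply: (opposite_class_clique h eU fU gU m') => //.
    by rewrite yA (negPf eA).
  by rewrite zA (negPf eA).
exists (col a b); split=> [y z yU zU yz|x y z xU yU zU xy xz k1 k2].
  by have [yA /esym zA|yA /esym zA] := boolP (y \in A); [apply: cA | apply: cB] => //; rewrite zA.
apply: contrapT => /eqP yz.
have yzA : (y \in A) = (z \in A).
  by move: xy xz; case: (x \in A); case: (y \in A); case: (z \in A).
have k3 : col y z = col a b.
  move: yzA; have [yA /esym zA|yA /esym zA] := boolP (y \in A).
    exact: cA.
  by apply: cB => //; rewrite zA.
have ne u v : (u \in A) != (v \in A) -> u != v by apply: contraNneq => ->.
have mm := mono_of_eq (ne _ _ xy) yz (ne _ _ xz) k1 k3 k2.
by have := mono_one_class h xU yU zU mm; rewrite (negPf xy).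
Qed.

End Cover.

(** * From covers to colourings *)

(** A square is 0 or 1 modulo 4, according to its parity. *)
Lemma tauE (R : pzRingType) (m : nat) : (0 < m)%N ->
  tau R m = 4 * (((m - 1) ^ 2) %/ 4)%:R.
Proof.
move=> m0; have E : ((m - 1) ^ 2 = 4 * (((m - 1) ^ 2) %/ 4) + ~~ odd m)%N.
  have [k [->|->]] : exists k, m = k.*2.+1 \/ m = k.+1.*2.
    exists (m.-1)./2; have := odd_double_half m.-1; case: (odd _); lia.
    rewrite subSS subn0 /= odd_double -mul2n expnMn mulKn //; lia.
  rewrite odd_double /= (_ : (k.+1.*2 - 1 = 1 + k * 2)%N); last by lia.
  rewrite (_ : ((1 + k * 2) ^ 2 = (k ^ 2 + k) * 4 + 1)%N); last by lia.
  by rewrite divnMDl //; lia.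
have -> : tau R m = ((m - 1) ^ 2)%:R - (~~ odd m)%:R by rewrite natrX natrB.
by rewrite {1}E natrD addrK natrM.
Qed.

Section Colouring.
Variables (V : finType) (R : realType) (col : rel V).
Hypothesis symcol : symmetric col.
Hypothesis V26 : (26 <= #|V|)%N.
Implicit Types A : {set V}.

Lemma cover_of_pack : exists c : V -> V -> R, [/\ forall x y, c x y = c y x,
  forall x y, 0 <= c x y, forall x, c x x = 0,
  forall x y z, mono col x y z -> 1 <= c x y + c y z + c x z &
  3 * wsum c setT <= 2 * pack R col].
Proof.
have [c [csym c0 cxx cT cp]] := pack_cover R symcol; exists c; split=> //.
  by move=> x y z /andP[h /andP[/eqP e1 /eqP e2]]; exact: cT.
apply: le_trans cp; rewrite ler_pM2l // /wsum /wdeg.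
rewrite (eq_bigl xpredT) => [|x]; last by rewrite inE.
by apply: ler_sum => x _; rewrite (eq_bigl xpredT) // => y; rewrite inE.
Qed.

Lemma pack_lower : tau R #|V| <= 4 * pack R col.
Proof.
have [c [csym c0 cxx ccov cp]] := cover_of_pack.
have V24 : (24 <= #|[set: V]|)%N by rewrite cardsT; apply: leq_trans V26.
have V20 : (20 <= #|[set: V]|)%N by apply: leq_trans V24.
suff : tau R #|V| <= 6 * wsum c setT by lra.
have [[Z mZ Z2]|hV] := light_or_heavy c setT; last first.
  by have := heavy_exact symcol csym c0 cxx ccov hV V20; rewrite cardsT.
have := light_bound symcol csym c0 cxx ccov V24 mZ Z2; rewrite cardsT /tau.
by case: (odd _) => /=; lra.
Qed.

Lemma pack_eq_structure : 4 * pack R col = tau R #|V| ->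
  bip_minus_matching (red_graph col) \/ bip_minus_matching (blue_graph col).
Proof.
move=> eqp; have [c [csym c0 cxx ccov cp]] := cover_of_pack.
have V24 : (24 <= #|[set: V]|)%N by rewrite cardsT; apply: leq_trans V26.
have V20 : (20 <= #|[set: V]|)%N by apply: leq_trans V24.
have extV : extremal c setT.
  have le6 : 6 * wsum c setT <= tau R #|V| by lra.
  have [[Z mZ Z2]|hV] := light_or_heavy c setT.
    have := light_bound symcol csym c0 cxx ccov V24 mZ Z2; move: le6; rewrite cardsT /tau.
    by case: (odd _) => /=; lra.
  split=> //; first by rewrite cardsT.
  apply/eqP; rewrite eq_le {1}cardsT le6 /=.
  exact: (heavy_exact symcol csym c0 cxx ccov hV V20).
have [A0 A0V hA0] := extremal_structure symcol csym c0 cxx ccov extV.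
have [_ _ eqV] := extV.
(* [bip_minus_matching] names the larger side, so the classes may have to be exchanged. *)
have [A [hA Ale]] : exists A, split_by c setT A /\ (#|~: A| <= #|A|)%N.
  have [l|l] := leqP #|~: A0| #|A0|; first by exists A0.
  exists (~: A0); rewrite setCK; split; last exact: ltnW.
  by rewrite -setTD; exact: split_byC.
have bal := split_by_balanced cxx (subsetT A) hA eqV.
have sA : (#|A| + #|~: A| = #|V|)%N by rewrite cardsC.
have [cA cB] : #|A| = uphalf #|V| /\ #|~: A| = (#|V|./2)%N.
  have : (#|A| - #|~: A| = odd #|V|)%N.
    have : ((#|A| - #|~: A|) ^ 2)%N%:R = (odd #|V|)%:R :> R.
      by rewrite natrX natrB //; move: bal; rewrite cardsT setTD => ->.
    move/eqP; rewrite eqr_nat => /eqP; case: (odd _) => /= /eqP.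
      by rewrite -{2}(exp1n 2) eqn_exp2r // => /eqP.
    by rewrite expn_eq0 andbT => /eqP.
  move=> d; have := odd_double_half #|V|; rewrite uphalf_half; lia.
have A6 : (6 <= #|A|)%N by rewrite cA uphalf_half; have := odd_double_half #|V|; lia.
have B3 : (3 <= #|setT :\: A|)%N by rewrite setTD cB; have := odd_double_half #|V|; lia.
have [k [kin kcross]] := split_colours symcol ccov (subsetT A) hA A6 B3.
suff bip F : (forall x y, F x y = (x != y) && (col x y != k)) -> bip_minus_matching F.
  case: k kin kcross bip => kin kcross bip; [right | left]; apply: bip => x y.
    by rewrite /blue_graph; case: (col x y).
  by rewrite /red_graph; case: (col x y).
(* The bipartite graph has the colour other than [k]; the removed matching consists of the crossing
   pairs of colour [k]. *)
move=> FE; exists A, (fun x y => ((x \in A) != (y \in A)) && (col x y == k)).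
split=> //; split=> //; split; first by move=> x y; rewrite eq_sym symcol.
split; first by move=> x y /andP[].
split.
  by move=> x y z /andP[xy /eqP k1] /andP[xz /eqP k2]; apply: (kcross x y z); rewrite ?inE.
move=> x y; rewrite FE; have [->|xy] := eqVneq x y; first by rewrite eqxx.
have [e|ne] := eqVneq (x \in A) (y \in A); last by [].
by rewrite kin ?inE ?eqxx.
Qed.

(** [F] is bipartite and has the zero cover. A triangle of [G] meeting both classes would have two
    crossing edges at one vertex, but crossing edges of [G] lie in a matching; so 1/3 within the
    classes and 0 across covers [G]. *)
Lemma bip_pack_upper (F G : rel V) : symmetric F -> symmetric G ->
  bip_minus_matching F -> (forall x y, G x y -> ~~ F x y) ->
  4 * (3 * (nu_star R F + nu_star R G)) <= tau R #|V|.
Proof.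
move=> symF symG [A [M [cA [cB [symM [MA [Mm FE]]]]]]] FG.
have nF : 2 * nu_star R F <= 0.
  rewrite (le_trans (nu_star_le symF (c := fun _ _ => 0 : R) _ _ _)) //.
    move=> x y z _ /and3P[]; rewrite !FE => /andP[h1 _] /andP[h2 _] /andP[h3 _].
    by move: h1 h2 h3; case: (x \in A); case: (y \in A); case: (z \in A).
  by rewrite big1 // => x _; rewrite big1.
pose c x y : R := if x == y then 0 else if (x \in A) == (y \in A) then 1 / 3 else 0.
have cxx x : c x x = 0 by rewrite /c eqxx.
have csym x y : c x y = c y x by rewrite /c eq_sym [in X in if _ then _ else if X then _ else _]eq_sym.
have c0 x y : 0 <= c x y by rewrite /c; case: ifP => // _; case: ifP => // _; lra.
have hA : split_by c setT A by move=> x y _ _ xy; rewrite /c (negPf xy).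
have MG x y : G x y -> (x \in A) != (y \in A) -> M x y.
  by move=> /FG; rewrite FE => h1 h2; move: h1; rewrite h2 /= negbK.
have nG : 2 * nu_star R G <= wsum c setT.
  apply: le_trans (nu_star_le symG (c := c) _ _ _) _ => //.
    move=> x y z /and3P[xy yz xz] /and3P[Gxy Gyz Gxz].
    have e1 : (x \in A) == (y \in A).
      apply: contraT => e1; have mxy := MG _ _ Gxy e1.
      have [e2|e2] := eqVneq (x \in A) (z \in A).
        have := MG _ _ Gyz; rewrite -e2 eq_sym e1 => /(_ isT) myz.
        by move: xz; rewrite (Mm y x z _ myz) ?eqxx // symM.
      by move: yz; rewrite (Mm x y z mxy (MG _ _ Gxz e2)) eqxx.
    have e2 : (x \in A) == (z \in A).
      apply: contraT => e2; have mxz := MG _ _ Gxz e2.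
      have := MG _ _ Gyz; rewrite -(eqP e1) => /(_ e2) myz.
      by move: xy; rewrite (Mm z x y) ?eqxx // symM.
    rewrite /c (negPf xy) (negPf yz) (negPf xz) e1 e2 -(eqP e1) e2; lra.
  rewrite /wsum /wdeg [leRHS](eq_bigl xpredT) => [|x]; last by rewrite inE.
  apply: ler_sum => x _; rewrite big_mkcond [leRHS](eq_bigl xpredT) => [|y]; last by rewrite inE.
  by apply: ler_sum => y _; case: ifP.
have := split_by_wt cxx (subsetT A) hA; rewrite setTD cB cA uphalf_half.
have := odd_double_half #|V|; rewrite /tau; set h := (#|V|./2)%N => <-.
rewrite oddD odd_double addbF oddb -muln2.
case: (odd _) => /=; rewrite ?add0n ?natrD natrM => w; nra.
Qed.

End Colouring.

Unset Implicit Arguments.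

Theorem theorem2p3 (R : realType) (n : nat) (col : rel 'I_n) :
  (26 <= n)%N -> symmetric col ->
  ((((n - 1) ^ 2) %/ 4)%:R <= pack R col) /\
  (pack R col = (((n - 1) ^ 2) %/ 4)%:R <->
     bip_minus_matching (red_graph col) \/ bip_minus_matching (blue_graph col)).
Proof.
move=> n26 symcol; have V26 : (26 <= #|'I_n|)%N by rewrite card_ord.
have low := pack_lower R symcol V26.
have tE : tau R #|'I_n| = 4 * (((n - 1) ^ 2) %/ 4)%:R.
  by rewrite card_ord tauE // (leq_trans _ n26).
rewrite tE ler_pM2l // in low; split=> //; split=> [eqp|bip].
  by apply: (pack_eq_structure (R := R) symcol V26); rewrite eqp tE.
have symr : symmetric (red_graph col) by move=> x y; rewrite /red_graph eq_sym symcol.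
have symb : symmetric (blue_graph col) by move=> x y; rewrite /blue_graph eq_sym symcol.
apply/eqP; rewrite eq_le low andbT -(@ler_pM2l _ 4) // -tE.
case: bip => bip.
  apply: (bip_pack_upper R symr symb bip) => x y; rewrite /red_graph /blue_graph.
  by case: (x != y); case: (col x y).
rewrite /pack addrC; apply: (bip_pack_upper R symb symr bip) => x y.
by rewrite /red_graph /blue_graph; case: (x != y); case: (col x y).
Qed.
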